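(* Let $p > 1$ be an integer. For any strictly accretive element $a$ of a unital Banach algebra, Halley's method for the $p$th root of $a$, $$X_{k+1} = X_k \; \frac{(p-1)X_k^p+(p+1)a}{(p+1)X_k^p+(p-1)a},$$ with initial point $X_0=I$, converges to $a^{\frac{1}{p}}$.
   Context: A unital Banach algebra $A$ is a complex Banach algebra with an identity of norm $1$; the identity is denoted by $1$ or $I$. The states of $A$ are the norm $1$ functionals $\varphi$ on $A$ with $\varphi(1)=1$, and the numerical range of $x \in A$ is $W(x) = \{\varphi(x) : \varphi \text{ a state of } A\}$. An element $x$ is strictly accretive if $W(x)$ is contained in the open right half plane. The quotient in the iteration denotes multiplication of the numerator by the inverse of the denominator (all the elements involved commute). Here $a^{\frac{1}{p}}$ is the principal $p$th root of $a$: the unique $p$th root with spectrum in the interior of the sector $S_{\frac{\pi}{p}}$ of complex numbers with argument in $[-\frac{\pi}{p}, \frac{\pi}{p}]$. Convergence is in the norm of $A$. *)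

(* Defs.v *)
(* MathComp / MathComp-Analysis *)
From HB Require Import structures.
From mathcomp Require Import all_boot all_order all_algebra.
From mathcomp Require Import all_classical all_reals all_analysis.
From mathcomp Require Export complex.

Set Implicit Arguments.
Unset Strict Implicit.
Unset Printing Implicit Defensive.

Import Order.TTheory GRing.Theory Num.Theory.
Import numFieldNormedType.Exports.

Local Open Scope classical_set_scope.
Local Open Scope ring_scope.
Local Open Scope complex_scope.

(* HB rejects a structure joining normedModType with a ring structure (it would
   be a missing join below numDomainType), hence the explicit norm. The
   unitRingType layer is no restriction: it names the (two-sided) invertible
   elements and their inverses, which are determined by the ring. *)
HB.mixin Record isUnitalBanachAlgebra (R : realType) A
    & GRing.UnitAlgebra R[i] A := {
  bnorm : A -> R;
  bnormD : forall x y : A, bnorm (x + y) <= bnorm x + bnorm y;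
  bnormZ : forall (c : R[i]) (x : A),
    bnorm (c *: x) = ComplexField.Normc.normc c * bnorm x;
  bnorm0_eq0 : forall x : A, bnorm x = 0 -> x = 0;
  bnormM : forall x y : A, bnorm (x * y) <= bnorm x * bnorm y;
  bnorm1 : bnorm 1 = 1;
  bnorm_complete : forall u : nat -> A,
    (forall e : R, 0 < e -> exists N : nat, forall m n : nat,
        (N <= m)%N -> (N <= n)%N -> bnorm (u m - u n) < e) ->
    exists l : A, (fun n => bnorm (u n - l)) @ \oo --> (0 : R)
}.

#[short(type="unitalBanachAlgType")]
HB.structure Definition UnitalBanachAlgebra (R : realType) :=
  {A of GRing.UnitAlgebra R[i] A & isUnitalBanachAlgebra R A}.

Definition norm_cvg (R : realType) (A : unitalBanachAlgType R)
    (u : nat -> A) (l : A) : Prop :=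
  (fun n => bnorm (u n - l)) @ \oo --> (0 : R).

Section NumericalRange.
Variables (R : realType) (A : unitalBanachAlgType R).
Implicit Types (x : A) (phi : {scalar A}).

(* The value is +oo when phi is unbounded. *)
Definition functional_norm phi : \bar R :=
  ereal_sup
    [set (ComplexField.Normc.normc (phi x))%:E | x in [set x : A | bnorm x <= 1]].

Definition state phi : Prop := functional_norm phi = 1%E /\ phi 1 = 1.

Definition numerical_range x : set R[i] :=
  [set z | exists2 phi : {scalar A}, state phi & z = phi x].

Definition strictly_accretive x : Prop :=
  numerical_range x `<=` [set z | 0 < complex.Re z].

Definition spectrum x : set R[i] :=
  [set z | z%:A - x \isn't a GRing.unit].

End NumericalRange.

(* The vertex 0 is included. The regular algebra R[i]^o carries the usual
   topology of the complex plane. *)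
Definition sector (R : realType) (theta : R) : set R[i]^o :=
  [set z | exists r t : R,
     [/\ 0 <= r, `|t| <= theta & z = (r * cos t) +i* (r * sin t)]].

Definition principal_root (R : realType) (A : unitalBanachAlgType R)
    (p : nat) (a b : A) : Prop :=
  b ^+ p = a /\ spectrum b `<=` interior (sector (pi / p%:R : R)).

Section Halley.
Variables (R : realType) (A : unitalBanachAlgType R) (p : nat) (a : A).

Definition halley_num (x : A) : A := p.-1%:R * x ^+ p + p.+1%:R * a.
Definition halley_den (x : A) : A := p.+1%:R * x ^+ p + p.-1%:R * a.

Definition halley (k : nat) : A :=
  iter k (fun x => x * (halley_num x / halley_den x)) 1.

End Halley.

(* Main.v *)
(* Only the spectrum of [a] matters: by Hahn-Banach every spectral value of [a]
   is the value at [a] of a state, so the spectrum lies in the open right half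
   plane. With [u_k = (X_k^p - a) / (X_k^p + a)] the iteration becomes
   [X_{k+1} = X_k (p - u_k) / (p + u_k)] and [u_{k+1} = f u_k] for a rational
   function [f] that does not depend on [a] and satisfies [|f z| <= |z|^3] on
   the closed unit disc. By spectral mapping the spectral radius of [u_k], which
   is smaller than [1] for [k = 0], tends to [0]. Once it is small, a seminorm
   adapted to [u_k] turns [f] into a contraction, so [u_k] tends to [0]
   geometrically and [X_k] converges to a root of [a].

   Each [X_k] is a rational function of [a]. Following the argument of the
   scalar iterates shows that its spectrum lies in the sector, and the spectrum
   of the limit follows by perturbation. If [b] is another principal root, the
   spectral idempotents of [b / X] at nontrivial roots of unity would yield
   spectral values of [X] and [b] that differ by a nontrivial [p]th root of
   unity, which the sector does not allow. *)
Require Import Defs.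
From HB Require Import structures.
From mathcomp Require Import all_boot all_order all_algebra.
From mathcomp Require Import all_classical all_reals all_analysis.
From mathcomp Require Import ring lra.

Set Implicit Arguments.
Unset Strict Implicit.
Unset Printing Implicit Defensive.

Import Order.TTheory GRing.Theory Num.Theory.
Import numFieldNormedType.Exports.

Local Open Scope classical_set_scope.
Local Open Scope ring_scope.
Local Open Scope complex_scope.

(** [A] need not be commutative and nothing keeps the norm of [u_0] below [1], so every estimate has
    to come from spectra. The spectral radius enters only through the existence of one power of
    small norm. Averaging resolvents over the two square roots of a point provides such a power
    [u ^ (2 ^ m)] without contour integrals. Spectral mapping is used only for powers and for
    fractions of polynomials, where splitting a polynomial over [R[i]] into linear factors is
    enough. What is built from [a] stays in its bicommutant, which is closed under inverses and
    limits, so these elements commute with one another and with every other root of [a]. The element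
    [u_k] is the Cayley transform of [X_k^p / a]: it exchanges the right half plane and the unit
    disc, and the cubic bound on [f] reflects the order of Halley's method. The constants of the
    contraction are fixed before the seminorm, because the seminorm is built from them. *)

Local Notation normc := ComplexField.Normc.normc.

(** * Complex modulus and norm convergence *)

Section ComplexModulus.
Variable R : rcfType.
Implicit Types (x y : R) (z w : R[i]).

Lemma normr_normc z : `|z| = (normc z)%:C.
Proof. by rewrite normc_def; case: z. Qed.

Lemma normc_ge0 z : 0 <= normc z.
Proof. by rewrite -lecR -normr_normc normr_ge0. Qed.

Lemma normcR x : normc x%:C = `|x|.
Proof. by rewrite /= expr0n addr0 sqrtr_sqr. Qed.

Lemma normcX z n : normc (z ^+ n) = normc z ^+ n.
Proof. by apply: (@complexI R); rewrite -normr_normc normrX rmorphXn. Qed.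

Lemma normc_nat n : normc (n%:R : R[i]) = n%:R.
Proof. by rewrite -(rmorph_nat (real_complex R)) normcR ger0_norm. Qed.

Lemma normc_eq0 z : (normc z == 0) = (z == 0).
Proof. by rewrite -(normr_eq0 z) normr_normc -(inj_eq (@complexI R)). Qed.

Lemma normc_gt0 z : (0 < normc z) = (z != 0).
Proof. by rewrite lt0r normc_eq0 normc_ge0 andbT. Qed.

Lemma normcM z w : normc (z * w) = normc z * normc w.
Proof. exact: ComplexField.Normc.normcM. Qed.

Lemma normcV z : normc z^-1 = (normc z)^-1.
Proof. exact: ComplexField.Normc.normcV. Qed.

Lemma normc1 : normc (1 : R[i]) = 1.
Proof. exact: ComplexField.Normc.normc1. Qed.

Lemma normc0 : normc (0 : R[i]) = 0.
Proof. exact: ComplexField.Normc.normc0. Qed.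

Lemma normcN z : normc (- z) = normc z.
Proof. by apply: (@complexI R); rewrite -!normr_normc normrN. Qed.

Lemma ler_normcD z w : normc (z + w) <= normc z + normc w.
Proof. by rewrite -lecR rmorphD -!normr_normc ler_normD. Qed.

Lemma normcBC z w : normc (z - w) = normc (w - z).
Proof. by rewrite -normcN opprB. Qed.

Lemma ger_normcB z w : normc z - normc w <= normc (z - w).
Proof. by rewrite lerBlDr -{1}[z](subrK w) ler_normcD. Qed.

Lemma Re_le_normc z : `|complex.Re z| <= normc z.
Proof. by rewrite -lecR -normr_normc normc_ge_Re. Qed.

Lemma Im_le_normc z : `|complex.Im z| <= normc z.
Proof.
case: z => a b; apply: le_trans (_ : Num.sqrt (b ^+ 2) <= _).
  by rewrite sqrtr_sqr.
by apply: ler_wsqrtr; rewrite lerDr sqr_ge0.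
Qed.

Lemma sqr_normcE z : normc z ^+ 2 = complex.Re z ^+ 2 + complex.Im z ^+ 2.
Proof. by case: z => a b; rewrite sqr_sqrtr // addr_ge0 // sqr_ge0. Qed.

Lemma normc_le_ReIm z : normc z <= `|complex.Re z| + `|complex.Im z|.
Proof.
rewrite -(@ler_pXn2r _ 2) ?nnegrE ?normc_ge0 ?addr_ge0 // sqr_normcE sqrrD.
by rewrite !real_normK ?num_real // -addrA lerD2l lerDr mulrn_wge0 // mulr_ge0.
Qed.

End ComplexModulus.

Section BanachAlgebra.
Variables (R : realType) (A : unitalBanachAlgType R).
Implicit Types (x y z : A) (c : R[i]).

Lemma bnorm0 : bnorm (0 : A) = 0.
Proof. by rewrite -(scale0r (0 : A)) bnormZ normc0 mul0r. Qed.

Lemma bnormN x : bnorm (- x) = bnorm x.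
Proof.
by rewrite -scaleN1r bnormZ normcN normc1 mul1r.
Qed.

Lemma bnormBC x y : bnorm (x - y) = bnorm (y - x).
Proof. by rewrite -bnormN opprB. Qed.

Lemma bnorm_ge0 x : 0 <= bnorm x.
Proof.
have := bnormD x (- x); rewrite subrr bnorm0 bnormN.
by rewrite -mulr2n pmulrn_lge0.
Qed.

Lemma bnormB x y : bnorm (x - y) <= bnorm x + bnorm y.
Proof. by rewrite -(bnormN y) bnormD. Qed.

Lemma bnorm_distD z x y : bnorm (x - y) <= bnorm (x - z) + bnorm (z - y).
Proof. by rewrite -[x - y](subrKA z) bnormD. Qed.

Lemma bnormX x n : bnorm (x ^+ n) <= bnorm x ^+ n.
Proof.
elim: n => [|n IH]; first by rewrite !expr0 bnorm1.
by rewrite !exprS (le_trans (bnormM _ _)) // ler_wpM2l // bnorm_ge0.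
Qed.

Lemma bnorm_eq0 x : (bnorm x == 0) = (x == 0).
Proof. by apply/eqP/eqP => [/bnorm0_eq0 //|->]; rewrite bnorm0. Qed.

Lemma bnorm_scalar c : bnorm (c%:A : A) = normc c.
Proof. by rewrite bnormZ bnorm1 mulr1. Qed.

Lemma bnorm_cvgP (u : nat -> A) (l : A) :
  norm_cvg u l <->
  forall e : R, 0 < e -> exists N, forall n, (N <= n)%N -> bnorm (u n - l) < e.
Proof.
split=> [/cvgrPdist_lt cv e /cv [N _ cN]|h].
  exists N => n /cN; rewrite /= sub0r normrN.
  by rewrite ger0_norm // bnorm_ge0.
apply/cvgrPdist_lt => e /h [N cN]; exists N => // n /= /cN.
by rewrite sub0r normrN ger0_norm // bnorm_ge0.
Qed.

Lemma bnorm_cvg_unique (u : nat -> A) l1 l2 :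
  norm_cvg u l1 -> norm_cvg u l2 -> l1 = l2.
Proof.
move=> /bnorm_cvgP h1 /bnorm_cvgP h2; apply/eqP; rewrite -subr_eq0 -bnorm_eq0.
rewrite eq_le bnorm_ge0 andbT; apply/ler_addgt0Pl => e e0.
rewrite addr0; have [N1 c1] := h1 (e / 2) ltac:(by rewrite divr_gt0).
have [N2 c2] := h2 (e / 2) ltac:(by rewrite divr_gt0).
rewrite (le_trans (bnorm_distD (u (maxn N1 N2)) _ _)) // (splitr e).
rewrite ltW // ltrD ?c2 ?leq_maxr //.
by rewrite bnormBC c1 ?leq_maxl.
Qed.

Lemma bnorm_cvg_cst x : norm_cvg (fun=> x) x.
Proof. by apply/bnorm_cvgP => e e0; exists 0%N => n _; rewrite subrr bnorm0. Qed.

Lemma eq_bnorm_cvg (u v : nat -> A) l : u =1 v -> norm_cvg u l -> norm_cvg v l.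
Proof. by move=> /funext ->. Qed.

Lemma bnorm_cvgD (u v : nat -> A) l m :
  norm_cvg u l -> norm_cvg v m -> norm_cvg (fun n => u n + v n) (l + m).
Proof.
move=> /bnorm_cvgP h1 /bnorm_cvgP h2; apply/bnorm_cvgP => e e0.
have [N1 c1] := h1 (e / 2) ltac:(by rewrite divr_gt0).
have [N2 c2] := h2 (e / 2) ltac:(by rewrite divr_gt0).
exists (maxn N1 N2) => n; rewrite geq_max => /andP[/c1 k1 /c2 k2].
by rewrite opprD addrACA (le_lt_trans (bnormD _ _)) // (splitr e) ltrD.
Qed.

Lemma bnorm_cvgM (u v : nat -> A) l m :
  norm_cvg u l -> norm_cvg v m -> norm_cvg (fun n => u n * v n) (l * m).
Proof.
move=> /bnorm_cvgP h1 /bnorm_cvgP h2; apply/bnorm_cvgP => e e0.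
set B := bnorm l + 1; set D := bnorm m + 1.
have B0 : 0 < B by rewrite ltr_wpDl // bnorm_ge0.
have D0 : 0 < D by rewrite ltr_wpDl // bnorm_ge0.
have [N0 c0] := h1 1 ltr01.
have [N1 c1] := h1 (e / 2 / D) ltac:(by rewrite !divr_gt0).
have [N2 c2] := h2 (e / 2 / B) ltac:(by rewrite !divr_gt0).
exists (maxn N0 (maxn N1 N2)) => n.
rewrite !geq_max => /and3P[/c0 k0 /c1 k1 /c2 k2].
have uB : bnorm (u n) <= B.
  rewrite -[u n](subrK l) (le_trans (bnormD _ _)) // /B addrC lerD2l.
  exact: ltW.
have -> : u n * v n - l * m = u n * (v n - m) + (u n - l) * m.
  by rewrite mulrBr mulrBl addrA subrK.
rewrite (le_lt_trans (bnormD _ _)) // (splitr e).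
apply: ler_ltD.
  rewrite (le_trans (bnormM _ _)) //.
  rewrite (le_trans (ler_pM (bnorm_ge0 _) (bnorm_ge0 _) uB (ltW k2))) //.
  by rewrite mulrCA divff ?gt_eqF // mulr1.
rewrite (le_lt_trans (bnormM _ _)) //.
rewrite (@le_lt_trans _ _ (bnorm (u n - l) * D)) //.
  by rewrite ler_wpM2l ?bnorm_ge0 // /D lerDl.
by rewrite -ltr_pdivlMr.
Qed.

Lemma bnorm_cvgX (u : nat -> A) l k :
  norm_cvg u l -> norm_cvg (fun n => u n ^+ k) (l ^+ k).
Proof.
move=> h; elim: k => [|k IH].
  by apply: (eq_bnorm_cvg _ (bnorm_cvg_cst _)) => n; rewrite expr0.
rewrite exprS; apply: (eq_bnorm_cvg _ (bnorm_cvgM h IH)) => n.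
by rewrite exprS.
Qed.

Lemma bnorm_cvg_shift (u : nat -> A) l k :
  norm_cvg (fun n => u (n + k)%N) l -> norm_cvg u l.
Proof.
move=> /bnorm_cvgP h; apply/bnorm_cvgP => e /h [N cN]; exists (N + k)%N => n Nn.
have kn : (k <= n)%N by apply: leq_trans Nn; rewrite leq_addl.
by have := cN (n - k)%N; rewrite subnK // leq_subRL // addnC; apply.
Qed.

Lemma bnorm_cvg_geometric (u : nat -> A) (C r : R) :
  0 <= r < 1 -> (forall n, bnorm (u n.+1 - u n) <= C * r ^+ n) ->
  exists l, norm_cvg u l.
Proof.
move=> /andP[r0 r1] h; apply: bnorm_complete => e e0.
have C0 : 0 <= C by have := h 0%N; rewrite expr0 mulr1; apply/le_trans/bnorm_ge0.
have s0 : 0 < 1 - r by rewrite subr_gt0.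
(* The finite geometric sum is kept in closed form so that the induction on [k] is an identity;
   [1 - r ^+ k] is bounded by [1] afterwards. *)
have tail N k : bnorm (u (N + k)%N - u N) <= C * r ^+ N / (1 - r) * (1 - r ^+ k).
  elim: k => [|k IH]; first by rewrite addn0 subrr bnorm0 expr0 subrr mulr0.
  rewrite (le_trans (bnorm_distD (u (N + k)%N) _ _)) // addnS.
  rewrite (le_trans (lerD (h _) IH)) // exprD exprS.
  rewrite le_eqVlt; apply/orP; left; apply/eqP.
  have : 1 - r != 0 by rewrite gt_eqF.
  by move=> ?; field.
have [N hN] : exists N, C * r ^+ N / (1 - r) < e / 2.
  have /cvgrPdist_lt/(_ ((1 - r) * (e / 2) / (C + 1))) :=
    cvg_expr (R := R) (z := r) ltac:(by rewrite ger0_norm).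
  case=> [|N _ /(_ N (leqnn _))].
    by rewrite divr_gt0 // ?mulr_gt0 ?divr_gt0 // ltr_wpDl.
  rewrite /= sub0r normrN ger0_norm ?exprn_ge0 // => hN; exists N.
  rewrite ltr_pdivrMr // mulrC (@le_lt_trans _ _ (r ^+ N * (C + 1))) //.
    by rewrite ler_wpM2l ?exprn_ge0 // lerDl.
  by rewrite -ltr_pdivlMr ?ltr_wpDl // [e / 2 * _]mulrC.
have far m : (N <= m)%N -> bnorm (u m - u N) < e / 2.
  move=> /subnKC <-; apply: le_lt_trans hN; apply: le_trans (tail _ _) _.
  rewrite ler_piMr ?divr_ge0 ?mulr_ge0 ?exprn_ge0 ?(ltW s0) //.
  by rewrite gerBl exprn_ge0.
exists N => m n /far hm /far hn.
rewrite (le_lt_trans (bnorm_distD (u N) _ _)) // (splitr e) ltrD //.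
by rewrite bnormBC.
Qed.

End BanachAlgebra.

(** * Resolvents and the spectral radius *)

Section Resolvent.
Variables (R : realType) (A : unitalBanachAlgType R).
Implicit Types (x y h u v : A) (c : R[i]).

Lemma mulr1_unit x y : x * y = 1 -> y * x = 1 ->
  (x \is a GRing.unit) /\ x^-1 = y.
Proof.
move=> xy yx; have xU : x \is a GRing.unit by apply/unitrP; exists y.
by split=> //; rewrite -[RHS](mulKr xU) xy mulr1.
Qed.

(** Neumann series: the partial sums of the powers of [y] converge to a two-sided inverse. *)
Lemma bnorm_lt1_unit y : bnorm y < 1 -> 1 - y \is a GRing.unit.
Proof.
move=> y1; pose s n := \sum_(i < n) y ^+ i.
have [||l sl] := @bnorm_cvg_geometric _ A s 1 (bnorm y).
- by rewrite bnorm_ge0.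
- by move=> n; rewrite /s big_ord_recr /= addrAC subrr add0r mul1r bnormX.
have y0 : norm_cvg (fun n => 1 - y ^+ n) 1.
  apply/bnorm_cvgP => e e0.
  have /cvgrPdist_lt/(_ e e0)[N _ cN] : (bnorm y) ^+ n @[n --> \oo] --> (0 : R).
    by apply: cvg_expr; rewrite ger0_norm ?bnorm_ge0.
  exists N => n /cN; rewrite /= sub0r normrN ger0_norm ?exprn_ge0 ?bnorm_ge0 //.
  by apply: le_lt_trans; rewrite addrC addKr bnormN bnormX.
have sE n : (1 - y) * s n = 1 - y ^+ n.
  by rewrite -opprB mulNr -subrX1 opprB.
have sE' n : s n * (1 - y) = 1 - y ^+ n.
  rewrite -sE; apply: commr_sym; apply: commr_sum => i _.
  apply: commrX; apply: commr_sym; apply: commrB; [exact: commr1|exact: commr_refl].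
apply/unitrP; exists l; split.
  apply: bnorm_cvg_unique _ y0; apply: eq_bnorm_cvg (sE') _.
  exact: bnorm_cvgM sl (bnorm_cvg_cst _).
apply: bnorm_cvg_unique _ y0; apply: eq_bnorm_cvg (sE) _.
exact: bnorm_cvgM (bnorm_cvg_cst _) sl.
Qed.

Lemma bnorm_inv_le y : bnorm y < 1 -> bnorm (1 - y)^-1 <= (1 - bnorm y)^-1.
Proof.
move=> y1; have U := bnorm_lt1_unit y1.
have E : (1 - y)^-1 = 1 + y * (1 - y)^-1.
  by apply: (mulIr U); rewrite mulrDl -mulrA mulVr // mul1r mulr1 subrK.
rewrite -[leRHS]mul1r ler_pdivlMr ?subr_gt0 // mulrBr mulr1 lerBlDr.
rewrite {1}E (le_trans (bnormD _ _)) // bnorm1 lerD2l mulrC.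
by rewrite mulrC (le_trans (bnormM _ _)) // mulrC.
Qed.

(** In [x - h = x (1 - x^-1 h)] the second factor has an inverse of norm at most [2]. *)
Lemma unit_perturbation x h : x \is a GRing.unit -> bnorm (x^-1 * h) <= 1 / 2 ->
  (x - h \is a GRing.unit) /\ bnorm (x - h)^-1 <= 2 * bnorm x^-1.
Proof.
move=> xU hx; have h1 : bnorm (x^-1 * h) < 1 by apply: le_lt_trans hx _; lra.
have E : x - h = x * (1 - x^-1 * h) by rewrite mulrBr mulr1 mulVKr.
have U := bnorm_lt1_unit h1.
rewrite E unitrMr //; split=> //; rewrite invrM //.
rewrite (le_trans (bnormM _ _)) // ler_wpM2r ?bnorm_ge0 //.
rewrite (le_trans (bnorm_inv_le h1)) // -[leRHS]invrK.
rewrite lef_pV2 ?posrE ?invr_gt0 ?subr_gt0 //; lra.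
Qed.

(** Compactness turns the local bounds given by [unit_perturbation] into a uniform one. The compact
    set is a square of real pairs; its points outside the disc satisfy [P] vacuously. *)
Lemma resolvent_bounded u :
  (forall c, normc c <= 1 -> 1 - c *: u \is a GRing.unit) ->
  exists2 M : R, 0 < M & forall c, normc c <= 1 -> bnorm (1 - c *: u)^-1 <= M.
Proof.
move=> hu; pose K := (`[-1, 1] `*` `[-1, 1] : set (R * R))%classic.
have /compact_near_coveringP cK : compact K.
  by apply: compact_setX; apply: segment_compact.
pose P (M : R) (ab : R * R) := normc (ab.1 +i* ab.2) <= 1 ->
  bnorm (1 - (ab.1 +i* ab.2) *: u)^-1 <= M.
have /= := cK R (+oo) P _ _; case.
  move=> [a b] _ /=; have [ab1|ab1] := leP (normc (a +i* b)) 1; last first.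
    pose e := (normc (a +i* b) - 1) / 2.
    (* Half the distance to the disc in each coordinate: the whole neighbourhood remains outside the
       disc. *)
    have e0 : 0 < e by rewrite divr_gt0 // subr_gt0.
    exists (ball (a, b) e, setT) => /=.
      split; [exact: nbhsx_ballx|exact: filterT].
    move=> [[a' b'] M] /= [[/= ha hb] _]; rewrite /P leNgt => /negP[] /=.
    have := ger_normcB (a +i* b) ((a - a') +i* (b - b')).
    have := normc_le_ReIm ((a - a') +i* (b - b')).
    rewrite /=; rewrite /ball /= in ha hb.
    have -> : a - (a - a') = a' by lra.
    have -> : b - (b - b') = b' by lra.
    move: ha hb; rewrite /e /=; lra.
  have U := hu _ ab1; set x := 1 - _ in U.
  (* Coordinates within [e] give a complex distance of at most [2 e], hence a relative perturbation
     of at most [1 / 2]. The [+ 1] keeps the denominator positive. *)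
  pose e := 1 / 4 / (bnorm x^-1 * bnorm u + 1).
  have d0 : 0 < bnorm x^-1 * bnorm u + 1.
    by rewrite ltr_wpDl // mulr_ge0 ?bnorm_ge0.
  have e0 : 0 < e by rewrite !divr_gt0.
  exists (ball (a, b) e, [set M | 2 * bnorm x^-1 < M]) => /=.
    split; [exact: nbhsx_ballx|apply: nbhs_pinfty_gt; exact: num_real].
  move=> [[a' b'] M] /= [[/= ha hb] hM] _; rewrite /ball /= in ha hb.
  have -> : 1 - (a' +i* b') *: u = x - ((a' - a) +i* (b' - b)) *: u.
    have -> : (a' - a) +i* (b' - b) = (a' +i* b') - (a +i* b) :> R[i] by [].
    by rewrite scalerBl /x -[LHS](subrKA ((a +i* b) *: u)) opprB.
  have [||_ hV] := @unit_perturbation x (((a' - a) +i* (b' - b)) *: u) => //.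
    rewrite (le_trans (bnormM _ _)) // bnormZ mulrCA.
    have hn : normc ((a' - a) +i* (b' - b)) <= 2 * e.
      apply: le_trans (normc_le_ReIm _) _ => /=.
      rewrite distrC [`|b' - b|]distrC; lra.
    apply: le_trans (ler_wpM2r _ hn) _; first by rewrite mulr_ge0 ?bnorm_ge0.
    rewrite /e; set k := bnorm _ * _.
    have k0 : 0 <= k by rewrite mulr_ge0 ?bnorm_ge0.
    rewrite mulrA mulrAC ler_pdivrMr //; lra.
  by apply: le_trans hV _; exact: ltW.
move=> M0 [_ hM].
pose M := Num.max (M0 + 1) 1; exists M => [|c c1]; first by rewrite lt_max ltr01 orbT.
have MM : M0 < M by rewrite lt_max ltrDl ltr01.
have := hM M MM (complex.Re c, complex.Im c).
have -> : P M (complex.Re c, complex.Im c) = (normc c <= 1 -> bnorm (1 - c *: u)^-1 <= M).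
  by rewrite /P /=; case: (c).
apply=> //; have := Re_le_normc c; have := Im_le_normc c; rewrite /K /=.
by rewrite !in_itv /= !ler_norml => /andP[i1 i2] /andP[r1 r2]; split; apply/andP; split; lra.
Qed.

End Resolvent.

(** * A power of small norm from the resolvent *)

Section SpectralRadius.
Variables (R : realType) (A : unitalBanachAlgType R).
Implicit Types (x y u v : A) (c : R[i]).

(** Equivalent to the spectrum of [u] lying in the open unit disc: [c] is the reciprocal of a
    spectral parameter, and [c = 0] needs no separate treatment. *)
Definition disc_resolvent_unit u :=
  forall c, normc c <= 1 -> 1 - c *: u \is a GRing.unit.

(* Averaging the resolvent of [v] at [d] and [- d] gives that of [v ^+ 2] at
   [d ^+ 2]; hence a modulus of radial continuity of the resolvent of [v] is
   inherited by [v ^+ 2]. *)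
Lemma resolvent_square v t (e : R) :
  disc_resolvent_unit v -> 0 <= t <= 1 ->
  (forall c, normc c <= 1 ->
    bnorm ((1 - c *: v)^-1 - (1 - (t%:C * c) *: v)^-1) <= e) ->
  disc_resolvent_unit (v ^+ 2) /\
  (forall c, normc c <= 1 ->
    bnorm ((1 - c *: v ^+ 2)^-1 - (1 - ((t ^+ 2)%:C * c) *: v ^+ 2)^-1) <= e).
Proof.
move=> vU /andP[t0 t1] ve.
have two : (2 : R[i]) != 0 by rewrite pnatr_eq0.
have factor d : 1 - d ^+ 2 *: v ^+ 2 = (1 - d *: v) * (1 - (- d) *: v).
  rewrite scaleNr opprK mulrDr mulr1 mulrBl mul1r addrA subrK.
  by rewrite -scalerAl -scalerAr scalerA -!expr2.
have avg d : normc d <= 1 -> (1 - d ^+ 2 *: v ^+ 2 \is a GRing.unit) /\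
    (1 - d ^+ 2 *: v ^+ 2)^-1 =
      2^-1 *: ((1 - d *: v)^-1 + (1 - (- d) *: v)^-1).
  move=> d1; have U := vU _ d1; have U' : 1 - (- d) *: v \is a GRing.unit.
    by apply: vU; rewrite normcN.
  have C : (1 - (- d) *: v) * (1 - d *: v) = (1 - d *: v) * (1 - (- d) *: v).
    by have := factor (- d); rewrite sqrrN opprK factor => ->.
  have S : (1 - d *: v) + (1 - (- d) *: v) = 2%:A.
    by rewrite scaleNr opprK addrACA addNr addr0 scaler_nat.
  have CV : (1 - d *: v)^-1 * (1 - (- d) *: v) = (1 - (- d) *: v) * (1 - d *: v)^-1.
    by apply: (mulrI U); rewrite mulVKr // mulrA -C mulrK.
  rewrite factor; apply: mulr1_unit.
    rewrite -scalerAr mulrDr -[in X in _ *: (_ + X)]mulrA mulrV // mulr1.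
    rewrite -C mulrK // addrC S scalerA mulVf // scale1r //.
  rewrite -scalerAl mulrDl mulKr // -C mulKr // addrC S scalerA mulVf // scale1r //.
have root c : normc c <= 1 -> exists2 d, d ^+ 2 = c & normc d <= 1.
  move=> c1; exists (sqrtc c); first exact: sqr_sqrtc.
  by rewrite -(@expr_le1 _ 2) ?normc_ge0 // -normcX sqr_sqrtc.
split=> c /root[d <- d1]; first by case: (avg d d1).
have td1 : normc (t%:C * d) <= 1.
  by rewrite normcM normcR ger0_norm // mulr_ile1 ?normc_ge0.
rewrite rmorphXn /= -exprMn (avg _ d1).2 (avg _ td1).2 -scalerBr bnormZ.
rewrite normcV normc_nat opprD addrACA mulrC ler_pdivrMr // -mulrN.
rewrite (le_trans (bnormD _ _)) // mulr_natr mulr2n lerD ?ve ?normcN //.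
Qed.

Lemma resolvent_pow2 u t (e : R) m :
  disc_resolvent_unit u -> 0 <= t <= 1 ->
  (forall c, normc c <= 1 ->
    bnorm ((1 - c *: u)^-1 - (1 - (t%:C * c) *: u)^-1) <= e) ->
  disc_resolvent_unit (u ^+ (2 ^ m)) /\
  (forall c, normc c <= 1 ->
    bnorm ((1 - c *: u ^+ (2 ^ m))^-1 -
           (1 - ((t ^+ (2 ^ m))%:C * c) *: u ^+ (2 ^ m))^-1) <= e).
Proof.
move=> uU t01 ue; elim: m => [|m [IU IH]]; first by rewrite expn0 !expr1.
rewrite expnSr !exprM; apply: resolvent_square => //.
by case/andP: t01 => ? ?; rewrite exprn_ge0 // exprn_ile1.
Qed.

(** An eventual bound on the norms of [(s u) ^ (2 ^ m)]. Only powers of two occur because squaring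
    is the operation that preserves the resolvent estimate. *)
Definition pow2_bounded u (s b : R) :=
  exists m0, forall m, (m0 <= m)%N ->
    s ^+ (2 ^ m) * bnorm (u ^+ (2 ^ m)) <= b.

Lemma pow2_bounded_shrink u (s r b : R) : 0 <= s -> 0 <= r < 1 -> 0 < b ->
  pow2_bounded u s 1 -> pow2_bounded u (r * s) b.
Proof.
move=> s0 /andP[r0 r1] b0 [m0 hm].
have /cvgrPdist_lt/(_ b b0)[N _ cN] : r ^+ n @[n --> \oo] --> (0 : R).
  by apply: cvg_expr; rewrite ger0_norm.
exists (maxn m0 N) => m; rewrite geq_max => /andP[/hm h1 Nm].
have /cN : (N <= 2 ^ m)%N by rewrite (leq_trans Nm) // ltnW // ltn_expl.
rewrite /= sub0r normrN ger0_norm ?exprn_ge0 // => h2.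
rewrite exprMn -mulrA -[leRHS]mulr1 ler_pM ?(ltW h2) ?exprn_ge0 //.
by rewrite mulr_ge0 ?bnorm_ge0 ?exprn_ge0.
Qed.

(* For small [(s u) ^ (2 ^ m)] the resolvent of [u ^ (2 ^ m)] at [s ^ (2 ^ m)] is
   close to [1], hence so is its value at [(s / t) ^ (2 ^ m)], uniformly in [m]. *)
Lemma pow2_bounded_step u (t s : R) :
  disc_resolvent_unit u -> 0 < t <= 1 -> 0 <= s -> s / t <= 1 ->
  (forall c, normc c <= 1 ->
    bnorm ((1 - c *: u)^-1 - (1 - (t%:C * c) *: u)^-1) <= 1 / 4) ->
  pow2_bounded u s (1 / 5) -> pow2_bounded u (s / t) 1.
Proof.
move=> uU /andP[t0 t1] s0 st1 ue [m0 hm]; exists m0 => m /hm {}hm.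
have [|IU IH] := @resolvent_pow2 u t (1 / 4) m uU _ ue; first by rewrite ltW.
set v := u ^+ (2 ^ m) in hm IU IH *.
pose c : R[i] := ((s / t) ^+ (2 ^ m))%:C.
have c0 : 0 <= s / t by rewrite divr_ge0 // ltW.
have nc : normc c = (s / t) ^+ (2 ^ m) by rewrite normcR ger0_norm // exprn_ge0.
have c1 : normc c <= 1 by rewrite nc exprn_ile1.
have := IH c c1; rewrite /c -rmorphM -exprMn mulrCA divff ?gt_eqF // mulr1.
set w := (s ^+ (2 ^ m))%:C *: v.
have w5 : bnorm w <= 1 / 5 by rewrite bnormZ normcR ger0_norm ?exprn_ge0.
have w1 : bnorm w < 1 by apply: le_lt_trans w5 _; lra.
have wU := bnorm_lt1_unit w1; have wV := bnorm_inv_le w1.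
have d4 : bnorm ((1 - w)^-1 - 1) <= 1 / 4.
  have -> : (1 - w)^-1 - 1 = (1 - w)^-1 * w.
    by apply: (mulrI wU); rewrite mulrBr mulVKr // mulrV // mulr1 opprB addrC subrK.
  have : bnorm (1 - w)^-1 <= 5 / 4.
    apply: le_trans wV _; rewrite -[leRHS]invrK lef_pV2 ?posrE ?subr_gt0 //; lra.
  move=> h; apply: le_trans (bnormM _ _) _.
  apply: le_trans (ler_pM (bnorm_ge0 _) (bnorm_ge0 _) h w5) _; lra.
rewrite -/c => hz; set y := c *: v in hz.
rewrite (_ : _ * _ = bnorm y); last by rewrite bnormZ nc.
have yU : 1 - y \is a GRing.unit by apply: IU.
set z := (1 - y)^-1 in hz.
have z2 : bnorm (z - 1) <= 1 / 2.
  apply: le_trans (bnorm_distD (1 - w)^-1 _ _) _; lra.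
have zy : z - 1 = z * y.
  have <- : z * (1 - y) = 1 by exact: mulVr yU.
  by rewrite mulrBr mulr1 opprB addrCA subrr addr0.
(* Hence [|y| <= 1/2 + |y|/2], that is [|y| <= 1]. The constant [1/5] puts the resolvent at [w]
   within [5/4 * 1/5 = 1/4] of [1], and the hypothesis adds another [1/4]. *)
have yE : y = (z - 1) - (z - 1) * y by rewrite mulrBl mul1r -zy opprB addrCA subrr addr0.
have := bnormB (z - 1) ((z - 1) * y); rewrite -yE.
have := bnormM (z - 1) y; have := ler_wpM2r (bnorm_ge0 y) z2; lra.
Qed.

(** This replaces the spectral radius formula. For a tiny radius [s] the powers of [s u] are bounded
    by the norm alone; uniform continuity of the resolvent lets the radius grow by a fixed factor at
    a time until it reaches [1]. *)
Lemma disc_resolvent_pow_le1 u : disc_resolvent_unit u ->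
  exists2 n, (0 < n)%N & bnorm (u ^+ n) <= 1.
Proof.
move=> uU; have [M M0 hM] := resolvent_bounded uU.
(* By the resolvent identity the resolvents at [c] and [t ^ 2 c] differ by at most
   [(1 - t ^ 2) K <= 2 (1 - t) K], and this [t] makes that at most [1/4]. *)
pose K := M ^+ 2 * bnorm u; pose t : R := 1 - 1 / 8 / (K + 1).
have K0 : 0 <= K by rewrite mulr_ge0 ?bnorm_ge0 ?sqr_ge0.
have K1 : 0 < K + 1 by rewrite ltr_wpDl.
have q0 : 0 < 1 / 8 / (K + 1) by rewrite !divr_gt0.
have q1 : 1 / 8 / (K + 1) <= 1 / 8.
  by rewrite ler_pdivrMr // ler_peMr // lerDr.
have qK : 1 / 8 / (K + 1) * K <= 1 / 8.
  by rewrite mulrAC ler_pdivrMr // ler_wpM2l // lerDl.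
have t0 : 0 < t by rewrite /t; lra.
have t1 : t < 1 by rewrite /t; lra.
have tt1 : t ^+ 2 <= 1 by rewrite exprn_ile1 ?ltW.
have tt0 : 0 < t ^+ 2 by rewrite exprn_gt0.
have cont c : normc c <= 1 ->
    bnorm ((1 - c *: u)^-1 - (1 - ((t ^+ 2)%:C * c) *: u)^-1) <= 1 / 4.
  move=> c1; set d := (t ^+ 2)%:C * c.
  have d1 : normc d <= 1.
    by rewrite normcM normcR ger0_norm ?sqr_ge0 // mulr_ile1 ?normc_ge0 ?sqr_ge0.
  have -> : (1 - c *: u)^-1 - (1 - d *: u)^-1 =
      (1 - c *: u)^-1 * ((c - d) *: u) * (1 - d *: u)^-1.
    have -> : (c - d) *: u = (1 - d *: u) - (1 - c *: u).
      by rewrite opprB [RHS]addrC subrKA scalerBl.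
    rewrite mulrBr mulVr ?uU // mulrBl mul1r -mulrA mulrV ?uU // mulr1.
    by [].
  have cd : normc (c - d) <= 1 - t ^+ 2.
    have -> : c - d = (1 - t ^+ 2)%:C * c by rewrite rmorphB mulrBl mul1r.
    rewrite normcM normcR ger0_norm ?subr_ge0 // -[leRHS]mulr1.
    by rewrite ler_wpM2l ?subr_ge0.
  apply: le_trans (bnormM _ _) _.
  apply: le_trans (ler_wpM2r (bnorm_ge0 _) (bnormM _ _)) _; rewrite bnormZ.
  have := hM _ d1; have := hM _ c1.
  move: (bnorm_ge0 (1 - c *: u)^-1) (bnorm_ge0 (1 - d *: u)^-1).
  set a1 := bnorm _; set a2 := bnorm _ => a10 a20 a1M a2M.
  apply: (@le_trans _ _ (M * ((1 - t ^+ 2) * bnorm u) * M)).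
    rewrite ler_pM ?mulr_ge0 ?normc_ge0 ?bnorm_ge0 //.
    rewrite ler_pM ?mulr_ge0 ?normc_ge0 ?bnorm_ge0 //.
    by rewrite ler_wpM2r ?bnorm_ge0.
  rewrite (_ : _ * M = (1 - t ^+ 2) * K); last by rewrite /K; ring.
  rewrite (@le_trans _ _ (2 * (1 - t) * K)) //.
    rewrite ler_wpM2r // /t; nra.
  rewrite /t; lra.
have [J hJ] : exists J, t ^+ J * bnorm u <= 1.
  have e0 : 0 < 1 / (bnorm u + 1) by rewrite divr_gt0 // ltr_wpDl ?bnorm_ge0.
  have /cvgrPdist_lt/(_ _ e0)[N _ cN] : t ^+ n @[n --> \oo] --> (0 : R).
    by apply: cvg_expr; rewrite ger0_norm // ltW.
  have := cN _ (leqnn N).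
  rewrite /= sub0r normrN ger0_norm ?exprn_ge0 ?(ltW t0) // => h; exists N.
  apply: (@le_trans _ _ (t ^+ N * (bnorm u + 1))).
    by rewrite ler_wpM2l ?exprn_ge0 ?(ltW t0) // lerDl.
  by rewrite -ler_pdivlMr ?ltr_wpDl ?bnorm_ge0 // ltW.
have tp j : 0 <= t ^+ j by rewrite exprn_ge0 ?ltW.
have base : pow2_bounded u (t ^+ J) 1.
  exists 0%N => m _; rewrite (@le_trans _ _ ((t ^+ J * bnorm u) ^+ (2 ^ m))) //.
    by rewrite exprMn; apply: ler_wpM2l; rewrite ?bnormX // exprn_ge0.
  by rewrite exprn_ile1 // mulr_ge0 ?bnorm_ge0.
have [m0 /(_ m0 (leqnn _))] : pow2_bounded u 1 1.
  elim: J base {hJ} => [|J IH]; first by rewrite expr0.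
  move=> h; apply: IH.
  (* Shrinking the radius by [t] brings the bound from [1] down to [1/5]; the step then enlarges the
     radius by [t^-2]. The net gain is a factor [1 / t]. *)
  have -> : t ^+ J = t * t ^+ J.+1 / t ^+ 2.
    by rewrite exprS; field; rewrite gt_eqF.
  apply: pow2_bounded_step => //; first by rewrite tt0.
  - by rewrite mulr_ge0 // ltW.
  - rewrite exprS mulrA -expr2 mulrAC divff ?gt_eqF // mul1r exprn_ile1 // ltW //.
  - by apply: pow2_bounded_shrink => //; rewrite (ltW t0).
rewrite expr1n mul1r => h; exists (2 ^ m0)%N => //.
by rewrite expn_gt0.
Qed.

End SpectralRadius.

(** * Spectral mapping and perturbation *)

Section Spectrum.
Variables (R : realType) (A : unitalBanachAlgType R).
Implicit Types (x y u v : A) (c z l : R[i]).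

Lemma spectrumNP u z : ~ spectrum u z -> z%:A - u \is a GRing.unit.
Proof. by rewrite /spectrum /=; case: (_ \is a _) => // /(_ isT). Qed.

Lemma scale_neq0_unit c x : c != 0 -> x \is a GRing.unit -> c *: x \is a GRing.unit.
Proof.
move=> c0 xU; rewrite -[x]mul1r scalerAl unitrMl //.
by apply/unitrP; exists c^-1%:A; rewrite -!scalerAl !mul1r !scalerA mulVf ?divff ?scale1r.
Qed.

Lemma commr_scalar c x : GRing.comm x c%:A.
Proof. by rewrite /GRing.comm mulr_algr mulr_algl. Qed.

Lemma commr_scale c x y : GRing.comm x y -> GRing.comm x (c *: y).
Proof. by rewrite /GRing.comm -scalerAr -scalerAl => ->. Qed.

Lemma pow_le_of_spectrum u (s : R) : 0 < s ->
  (forall z, spectrum u z -> normc z < s) ->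
  exists2 n, (0 < n)%N & bnorm (u ^+ n) <= s ^+ n.
Proof.
move=> s0 hs; have sC : s%:C != 0 by rewrite (fmorph_eq0 (real_complex R)) gt_eqF.
have [c c1|n n0] := @disc_resolvent_pow_le1 _ _ ((s%:C)^-1 *: u).
  have [->|c0] := eqVneq c 0; first by rewrite scale0r subr0 unitr1.
  have -> : 1 - c *: ((s%:C)^-1 *: u) = (c / s%:C) *: ((s%:C / c)%:A - u).
    rewrite scalerBr !scalerA mulrA divfK // divff // scale1r //.
  apply: scale_neq0_unit; first by rewrite mulf_neq0 // invr_eq0.
  apply: spectrumNP => /hs; rewrite normcM normcV normcR gtr0_norm //.
  rewrite ltr_pdivrMr ?normc_gt0 // ltr_pMr // => /lt_le_trans/(_ c1).
  by rewrite ltxx.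
rewrite exprZn bnormZ normcX normcV normcR gtr0_norm // exprVn.
by rewrite mulrC ler_pdivrMr ?exprn_gt0 // mul1r => h; exists n.
Qed.

(** With an empty spectrum, [u] is a unit and [pow_le_of_spectrum] applies to every positive [s].
    For [s = 1 / (2 |u^-1|)] it makes the norm of [1 = u^n u^-n] at most [2^-n]. *)
Lemma spectrum_nonempty u : exists z, spectrum u z.
Proof.
apply: contrapT => hn; have h0 z : ~ spectrum u z by move=> hz; apply: hn; exists z.
have U : u \is a GRing.unit.
  by have := spectrumNP (h0 0); rewrite scale0r sub0r unitrN.
have iv0 : 0 < bnorm u^-1.
  by rewrite lt0r bnorm_ge0 andbT bnorm_eq0 invr_eq0; apply/eqP => u0; rewrite u0 unitr0 in U.
pose s := 1 / 2 / bnorm u^-1; have s0 : 0 < s by rewrite !divr_gt0.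
have [z /h0 //|n n0 hu] := pow_le_of_spectrum s0 (u := u).
have : bnorm (1 : A) = 1 by exact: bnorm1.
rewrite -(expr1n A n) -(mulrV U) exprMn_comm; last by rewrite /GRing.comm mulrV // mulVr.
have h : bnorm (u ^+ n * u^-1 ^+ n) <= (1 / 2) ^+ n.
  apply: le_trans (bnormM _ _) _.
  have -> : (1 / 2 : R) ^+ n = s ^+ n * bnorm u^-1 ^+ n.
    by rewrite -exprMn /s divfK // gt_eqF.
  by rewrite ler_pM ?bnorm_ge0 ?bnormX.
move=> e; move: h; rewrite e leNgt => /negP[].
by rewrite exprn_ilt1 ?lt0n_neq0 //; lra.
Qed.

(** Since [R[i]] is algebraically closed, [q] splits into linear factors, each of which is a unit at
    [y]. *)
Lemma horner_alg_unit (q : {poly R[i]}) y :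
  q != 0 -> (forall z, root q z -> z%:A - y \is a GRing.unit) ->
  horner_alg y q \is a GRing.unit.
Proof.
move=> q0 h; have [r qE] := closed_field_poly_normal q.
have {}h z : z \in r -> z%:A - y \is a GRing.unit.
  move=> zr; apply: h; rewrite qE rootZ ?lead_coef_eq0 //.
  by rewrite root_prod_XsubC.
rewrite qE linearZ /= mulr_algl; apply: scale_neq0_unit; first by rewrite lead_coef_eq0.
rewrite rmorph_prod big_seq; elim/big_ind: _ => [|a b aU bU|z zr].
- exact: unitr1.
- by rewrite unitrMl.
- by rewrite rmorphB /= horner_algX horner_algC -unitrN opprB h.
Qed.

(** As [l - N/D = (l D - N)/D] is not a unit at [y], the polynomial [l D - N] has a root in the
    spectrum of [y]. If it is zero, any spectral value will do, which is where nonemptiness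
    enters. *)
Lemma spectrum_fraction (N D : {poly R[i]}) y l :
  horner_alg y D \is a GRing.unit ->
  spectrum (horner_alg y N / horner_alg y D) l ->
  exists2 z, spectrum y z & N.[z] = l * D.[z].
Proof.
move=> DU hl; pose q := l *: D - N.
have qE z : q.[z] = l * D.[z] - N.[z] by rewrite hornerD hornerN hornerZ.
have [q0|q0] := eqVneq q 0.
  have [z hz] := spectrum_nonempty y; exists z => //.
  by have := qE z; rewrite q0 horner0 => /eqP; rewrite eq_sym subr_eq0 => /eqP ->.
apply: contrapT => hn.
suff : horner_alg y q \is a GRing.unit.
  rewrite /spectrum /= in hl; move: hl => /negP hl hq; apply: hl.
  have -> : l%:A - horner_alg y N / horner_alg y D = horner_alg y q / horner_alg y D.
    by rewrite /q linearB linearZ /= mulrBl mulr_algl -scalerAl mulrV.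
  by rewrite unitrMl ?unitrV.
apply: horner_alg_unit => // z rz; apply: spectrumNP => hz; apply: hn.
by exists z => //; move/rootP: rz; rewrite qE => /eqP; rewrite subr_eq0 => /eqP ->.
Qed.

Lemma spectrum_exp x n z : spectrum x z -> spectrum (x ^+ n) (z ^+ n).
Proof.
rewrite /spectrum /= => /negP h; apply/negP => U; apply: h.
have -> : z%:A = z *: (1 : A) by [].
move: U; have -> : (z ^+ n)%:A = (z%:A : A) ^+ n by rewrite exprZn expr1n.
rewrite subrXX_comm; last exact/commr_sym/commr_scalar.
rewrite unitrM_comm; first by case/andP.
apply: commr_sum => i _; apply: commrM; apply: commrX; apply: commr_sym.
  by apply: commrB; [exact: commr_refl|exact/commr_sym/commr_scalar].
by apply: commrB; [exact: commr_scalar|exact: commr_refl].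
Qed.

(** If [l] is farther than [e] from the spectrum of [y], a power of [e (l - y)^-1] has norm at most
    [1]. By commutation the same power of [d = (l - y)^-1 (x - y)] has norm below [1], and
    [l - x = (l - y) (1 - d)]. *)
Lemma spectrum_perturbation x y (e : R) l : 0 < e -> GRing.comm x y ->
  bnorm (x - y) < e -> spectrum x l ->
  exists2 m, spectrum y m & normc (l - m) <= e.
Proof.
move=> e0 xy xye hl; apply: contrapT => hn.
have far m : spectrum y m -> e < normc (l - m).
  by move=> hm; rewrite ltNge; apply/negP => hle; apply: hn; exists m.
pose w := l%:A - y; have wU : w \is a GRing.unit.
  by apply: spectrumNP => /far; rewrite subrr normc0 ltNge ltW.
have [c c1|n n0 hw] := @disc_resolvent_pow_le1 _ _ (e%:C *: w^-1).
  have -> : 1 - c *: (e%:C *: w^-1) = ((l - c * e%:C)%:A - y) * w^-1.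
    have -> : (l - c * e%:C)%:A - y = w - (c * e%:C)%:A.
      by rewrite scalerBl addrAC.
    by rewrite mulrBl mulrV // mulr_algl scalerA.
  rewrite unitrMl ?unitrV //; apply: spectrumNP => /far.
  rewrite opprB addrC subrK normcM normcR gtr0_norm // ltNge.
  by rewrite ler_piMl // ltW.
have wx : GRing.comm w (x - y).
  have h1 : GRing.comm w x.
    by apply: commr_sym; apply: commrB => //; exact: commr_scalar.
  apply: commrB => //; apply: commr_sym.
  by apply: commrB; [exact: commr_scalar|exact: commr_refl].
have wVx : GRing.comm w^-1 (x - y) by apply/commr_sym/commrV/commr_sym.
pose d := w^-1 * (x - y).
have dn : bnorm (d ^+ n) < 1.
  rewrite /d exprMn_comm //; apply: le_lt_trans (bnormM _ _) _.
  move: hw; rewrite exprZn bnormZ normcX normcR gtr0_norm // => hw.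
  have en : 0 < e ^+ n by rewrite exprn_gt0.
  have [z0|z0] := eqVneq (bnorm (w^-1 ^+ n)) 0; first by rewrite z0 mul0r.
  have zp : 0 < bnorm (w^-1 ^+ n) by rewrite lt0r z0 bnorm_ge0.
  apply: lt_le_trans hw; rewrite mulrC ltr_pM2r //.
  apply: le_lt_trans (bnormX _ _) _.
  by rewrite ltrXn2r ?nnegrE ?bnorm_ge0 ?ltW // -lt0n.
(* [1 - d] is a commuting factor of the unit [1 - d ^ n]. *)
have dU : 1 - d \is a GRing.unit.
  have := bnorm_lt1_unit dn; rewrite -opprB unitrN subrX1 unitrM_comm.
    by case/andP=> + _; rewrite -unitrN opprB.
  apply: commr_sum => i _; apply: commrX; apply: commr_sym.
  by apply: commrB; [exact: commr_refl|exact: commr1].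
move/negP: hl; apply.
have -> : l%:A - x = w * (1 - d).
  by rewrite mulrBr mulr1 mulVKr // /w opprB addrA subrK.
by rewrite unitrMl.
Qed.

(** The uniform resolvent bound on the closed disc extends invertibility a fixed distance [d] beyond
    it. The resulting [r < 1] is what makes the later powers of [r] tend to [0]. *)
Lemma disc_resolvent_spectrum u : disc_resolvent_unit u ->
  exists2 r : R, 0 < r < 1 & forall z, spectrum u z -> normc z <= r.
Proof.
move=> uU; have [M M0 hM] := resolvent_bounded uU.
pose K := M * bnorm u; have K0 : 0 <= K by rewrite mulr_ge0 ?bnorm_ge0 // ltW.
pose d := 1 / 2 / (K + 1); have K1 : 0 < K + 1 by rewrite ltr_wpDl.
have d0 : 0 < d by rewrite !divr_gt0.
exists (1 + d)^-1.
  by rewrite invr_gt0 addr_gt0 // invf_lt1 ?addr_gt0 // ltrDl.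
move=> z; apply: contraPP => /negP; rewrite -ltNge => hz /negP; apply.
have z0 : 0 < normc z by apply: lt_trans hz; rewrite invr_gt0 addr_gt0.
have zn0 : z != 0 by rewrite -normc_gt0.
have -> : z%:A - u = z *: (1 - z^-1 *: u) by rewrite scalerBr scalerA divff // scale1r.
apply: scale_neq0_unit => //.
have [h1|h1] := leP 1 (normc z).
  by apply: uU; rewrite normcV invf_le1.
have zi : normc z^-1 < 1 + d.
  by rewrite normcV -[ltRHS]invrK ltf_pV2 // posrE ?invr_gt0 ?addr_gt0.
have zi1 : 1 < normc z^-1 by rewrite normcV invf_gt1.
(* The radial projection of [z^-1] onto the unit circle, at distance [1 / |z| - 1 < d] from it. *)
pose c := (normc z)%:C / z.
have c1 : normc c = 1 by rewrite normcM normcV normcR gtr0_norm // divff // gt_eqF.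
have [||U _] := @unit_perturbation _ _ (1 - c *: u) ((z^-1 - c) *: u).
- by apply: uU; rewrite c1.
- apply: le_trans (bnormM _ _) _; rewrite bnormZ.
  have -> : z^-1 - c = (1 - normc z)%:C * z^-1.
    by rewrite rmorphB mulrBl mul1r.
  rewrite normcM normcR ger0_norm ?subr_ge0 ?(ltW h1) // [(1 - _) * _]mulrBl (mul1r (normc _)).
  rewrite {2}normcV divff ?gt_eqF //.
    apply: (@le_trans _ _ (M * (d * bnorm u))).
    rewrite ler_pM ?bnorm_ge0 ?mulr_ge0 ?bnorm_ge0 ?hM ?c1 //; first lra.
    by rewrite ler_wpM2r ?bnorm_ge0 //; lra.
  rewrite mulrCA -/K /d mulrAC ler_pdivrMr // ler_wpM2l // lerDl //.
by move: U; rewrite scalerBl opprB addrA subrK.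
Qed.

End Spectrum.

(** * Spectrum and numerical range *)

Section HahnBanach.
Variables (R : realType) (A : unitalBanachAlgType R).
Implicit Types (x y : A) (p q : A -> R) (s t : R).

Definition sublinear q :=
  (forall x y, q (x + y) <= q x + q y) /\
  (forall t x, 0 <= t -> q (t%:C *: x) <= t * q x).

Lemma sublinear0 q : sublinear q -> q 0 = 0.
Proof.
case=> qD qZ; apply: le_anti; rewrite -{1}(scale0r (0 : A)).
have -> : (0 : R[i]) = (0 : R)%:C by [].
rewrite (le_trans (qZ _ _ _)) ?mul0r //=.
by have := qD 0 0; rewrite addr0 => h; lra.
Qed.

Lemma sublinear_opp q x : sublinear q -> - q (- x) <= q x.
Proof.
by move=> h; have := h.1 x (- x); rewrite subrr (sublinear0 h) => h'; lra.
Qed.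

(** The real [inf] is meaningful only for nonempty sets that are bounded below, hence the hypotheses
    on [D] and the lower bound [b] in the lemmas that follow. *)
Definition inf_family I (D : set I) (F : I -> A -> R) x : R :=
  inf [set F i x | i in D].

Section InfFamily.
Variables (I : Type) (D : set I) (F : I -> A -> R) (b : A -> R).
Hypothesis D0 : D !=set0.
Hypothesis bP : forall i x, D i -> b x <= F i x.

Lemma inf_family_le i x : D i -> inf_family D F x <= F i x.
Proof.
by move=> Di; apply: ge_inf; [exists (b x) => _ [j Dj <-]; exact: bP|exists i].
Qed.

Lemma inf_family_ge m x : (forall i, D i -> m <= F i x) -> m <= inf_family D F x.
Proof.
move=> h; apply: lb_le_inf; first by have [i Di] := D0; exists (F i x), i.
by move=> _ [i Di <-]; exact: h.
Qed.

(** One criterion for three uses: shifts of a functional, chains of functionals, and the distance to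
    a subspace. *)
Lemma inf_family_sublinear :
  (forall i j x y, D i -> D j ->
     exists2 k, D k & F k (x + y) <= F i x + F j y) ->
  (forall i t x, D i -> 0 <= t ->
     exists2 k, D k & F k (t%:C *: x) <= t * F i x) ->
  sublinear (inf_family D F).
Proof.
move=> hD hZ; split=> [x y|t x t0].
  rewrite -lerBlDr; apply: inf_family_ge => i Di.
  rewrite lerBlDr -lerBlDl; apply: inf_family_ge => j Dj.
  rewrite lerBlDl; have [k Dk] := hD i j x y Di Dj.
  exact/le_trans/inf_family_le.
have [e0|tn0] := eqVneq t 0.
  have [i Di] := D0; have [k Dk] := hZ i t x Di t0.
  by rewrite e0 !mul0r; exact/le_trans/inf_family_le.
have {}t0 : 0 < t by rewrite lt0r tn0.
rewrite mulrC -ler_pdivrMr //; apply: inf_family_ge => j Dj.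
rewrite ler_pdivrMr // mulrC; have [k Dk] := hZ j t x Dj (ltW t0).
exact/le_trans/inf_family_le.
Qed.

End InfFamily.

(** The parameter [s = 0] gives a functional below [q], and [s = 1] bounds it by [q (x + y) - q y].
    If [q] is minimal, this yields superadditivity. *)
Definition sublinear_shift q y :=
  inf_family [set s | 0 <= s] (fun s x => q (x + s%:C *: y) - s * q y).

Section SublinearShift.
Variables (q : A -> R) (y : A).
Hypothesis qS : sublinear q.

Let shift_lb s x : 0 <= s -> - q (- x) <= q (x + s%:C *: y) - s * q y.
Proof.
move=> s0; have := qS.1 (- x) (x + s%:C *: y); rewrite addrA addNr add0r.
have := qS.2 s y s0; have := sublinear_opp (s%:C *: y) qS.
have [-> _ _|sn0] := eqVneq s 0.
  by rewrite mul0r scale0r !addr0 sublinear0 // => h; lra.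
have sp : 0 < s by rewrite lt0r sn0.
have := qS.2 s^-1 (s%:C *: y) (ltW _); rewrite invr_gt0 => /(_ sp).
rewrite scalerA -rmorphM mulVf // scale1r ler_pdivlMl //; lra.
Qed.

Let nonneg0 : [set s : R | 0 <= s] !=set0.
Proof. by exists 0 => /=. Qed.

Lemma sublinear_shift_sublinear : sublinear (sublinear_shift q y).
Proof.
apply: (inf_family_sublinear nonneg0 shift_lb) => [s s' x z s0 s0'|s t x s0 t0].
  exists (s + s') => /=; first exact: addr_ge0.
  have := qS.1 (x + s%:C *: y) (z + s'%:C *: y).
  by rewrite addrACA -scalerDl -rmorphD mulrDl => h; lra.
exists (t * s) => /=; first exact: mulr_ge0.
have := qS.2 t (x + s%:C *: y) t0; rewrite scalerDr scalerA -rmorphM => h.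
by rewrite mulrBr mulrA lerB.
Qed.

Lemma sublinear_shift_le x : sublinear_shift q y x <= q x.
Proof.
have := inf_family_le shift_lb x (lexx 0 : [set s : R | 0 <= s] 0).
by rewrite scale0r addr0 mul0r subr0.
Qed.

Lemma sublinear_shift_le1 x : sublinear_shift q y x <= q (x + y) - q y.
Proof.
have := inf_family_le shift_lb x (ler01 : [set s : R | 0 <= s] 1).
by rewrite scale1r mul1r.
Qed.

End SublinearShift.

(* A minimal sublinear functional is linear: it is not lowered by any shift. *)
Lemma minimal_sublinear p : sublinear p ->
  exists g : A -> R, [/\ forall x, g x <= p x,
    forall x y, g (x + y) = g x + g y & forall t x, g (t%:C *: x) = t * g x].
Proof.
move=> pS; pose T := {q : A -> R | sublinear q /\ forall x, q x <= p x}.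
pose mk q (qS : sublinear q) (qp : forall x, q x <= p x) : T :=
  exist _ q (conj qS qp).
(* The pointwise order is reversed, so that a maximal element for Zorn's lemma is a minimal
   functional. *)
pose rel (f h : T) := `[< forall x, sval h x <= sval f x >].
have t0 : T by exists p.
have [||C Ctot|[g [gS gp]] gmin] := @ZL_preorder T t0 rel.
- by move=> f; apply/asboolP.
- move=> f h k /asboolP h1 /asboolP h2; apply/asboolP => x.
  exact: le_trans (h2 x) (h1 x).
- have [[c0 C0]|Cn] := pselect (C !=set0); last first.
    by exists t0 => s Cs; exfalso; apply: Cn; exists s.
  pose F (f : T) := sval f; have bP (f : T) x : C f -> - p (- x) <= F f x.
    move=> _; rewrite /F; case: f => f [fS fp] /=.
    by apply: le_trans (sublinear_opp x fS); rewrite lerN2.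
  have C1 : C !=set0 by exists c0.
  have mS : sublinear (inf_family C F).
    apply: (inf_family_sublinear C1 bP) => [f h x y Cf Ch|f t x Cf t0'].
      have [/asboolP fh|/asboolP hf] := Ctot _ _ Cf Ch.
        exists h => //; apply: le_trans ((svalP h).1.1 x y) _.
        by rewrite lerD2r; exact: fh.
      exists f => //; apply: le_trans ((svalP f).1.1 x y) _.
      by rewrite lerD2l; exact: hf.
    by exists f => //; exact: (svalP f).1.2.
  have mp x : inf_family C F x <= p x.
    exact: le_trans (inf_family_le bP x C0) ((svalP c0).2 x).
  exists (mk _ mS mp) => f Cf; apply/asboolP => x /=.
  exact: (inf_family_le bP x Cf).
have ge y x : g x + g y <= g (x + y).
  have sp z : sublinear_shift g y z <= p z.
    exact: le_trans (sublinear_shift_le y gS z) (gp z).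
  pose f := mk _ (sublinear_shift_sublinear y gS) sp.
  have /asboolP/(_ x) /= : rel f (mk g gS gp).
    by apply: gmin; apply/asboolP => z /=; exact: sublinear_shift_le.
  by have := sublinear_shift_le1 y gS x => h1 h2; lra.
have gD x y : g (x + y) = g x + g y.
  by apply: le_anti; rewrite gS.1 ge.
have gN x : g (- x) = - g x.
  by have := gD x (- x); rewrite subrr sublinear0 // => h; lra.
have gZ t x : 0 <= t -> g (t%:C *: x) = t * g x.
  move=> t0'; apply: le_anti; rewrite gS.2 //=.
  by have := gS.2 t (- x) t0'; rewrite scalerN !gN mulrN lerN2.
exists g; split=> // t x; have [/gZ //|tn] := leP 0 t.
have /gZ : 0 <= - t by lra.
by move/(_ x); rewrite rmorphN scaleNr gN mulNr => /oppr_inj.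
Qed.

(** Hahn-Banach for the distance [p0] to [J], which is [1] at the identity: a real functional below
    [p0] vanishes on [J], and its complexification is the state. *)
Lemma exists_state (J : set A) : J 0 -> (forall x y, J x -> J y -> J (x + y)) ->
  (forall c x, J x -> J (c *: x)) -> (forall x, J x -> 1 <= bnorm (1 + x)) ->
  exists2 phi : {scalar A}, state phi & forall x, J x -> phi x = 0.
Proof.
move=> J0 JD JZ J1.
have J_ne : J !=set0 by exists 0.
pose F (j x : A) := bnorm (x + j).
have bP j x : J j -> 0 <= F j x by move=> _; exact: bnorm_ge0.
pose p0 := inf_family J F.
have p0S : sublinear p0.
  apply: (inf_family_sublinear (b := fun=> 0) J_ne bP).
    move=> i j x y Ji Jj; exists (i + j); first exact: JD.
    by rewrite /F addrACA bnormD.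
  move=> i t x Ji t0; exists (t%:C *: i); first exact: JZ.
  by rewrite /F -scalerDr bnormZ normcR ger0_norm.
have p0_le x : p0 x <= bnorm x.
  by have := inf_family_le (b := fun=> 0) bP x J0; rewrite /F addr0.
have p0J x : J x -> p0 x <= 0.
  move=> /(JZ (-1)); rewrite scaleN1r => Jx.
  by have := inf_family_le (b := fun=> 0) bP x Jx; rewrite /F subrr bnorm0.
have p01 : p0 1 = 1.
  apply: le_anti; rewrite -{1}(bnorm1 (R := R) (s := A)) p0_le /=.
  exact: inf_family_ge.
(* Shifting by [1] beforehand forces [g (- 1) <= p0 0 - p0 1 = - 1], which settles [g 1 = 1]. *)
have [g [gp gD gZ]] := minimal_sublinear (sublinear_shift_sublinear 1 p0S).
have {}gp0 x : g x <= p0 x := le_trans (gp x) (sublinear_shift_le 1 p0S x).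
have gN x : g (- x) = - g x.
  by rewrite -scaleN1r -[-1](rmorphN1 (real_complex R)) gZ mulN1r.
have g1 : g 1 = 1.
  apply: le_anti; rewrite -{1}p01 gp0 /=.
  have := le_trans (gp (- 1)) (sublinear_shift_le1 1 p0S (- 1)).
  by rewrite addNr sublinear0 // gN p01; lra.
have gJ x : J x -> g x = 0.
  move=> Jx; have := le_trans (gp0 x) (p0J x Jx).
  have := JZ (-1) x Jx; rewrite scaleN1r => Jx'.
  by have := le_trans (gp0 (- x)) (p0J (- x) Jx'); rewrite gN; lra.
pose phi (x : A) : R[i] := (g x) +i* (- g ('i%C *: x)).
have iZ x : g ('i%C *: ('i%C *: x)) = - g x.
  by rewrite scalerA -expr2 sqr_i scaleN1r gN.
have cE (a b : R) x : (a +i* b) *: x = a%:C *: x + b%:C *: ('i%C *: x).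
  rewrite scalerA -scalerDl; congr (_ *: _).
  by rewrite [LHS]complexE /= mulrC.
have gc (a b : R) x : g ((a +i* b) *: x) = a * g x + b * g ('i%C *: x).
  by rewrite cE gD !gZ.
have phi_lin : scalar phi.
  move=> [a b] x y; rewrite /phi /= !scalerDr !gD (gc a b).
  have -> : 'i%C *: ((a +i* b) *: x) = (a +i* b) *: ('i%C *: x).
    by rewrite !scalerA mulrC.
  rewrite (gc a b) iZ; apply/eqP; rewrite eq_complex /=.
  by apply/andP; split; apply/eqP; ring.
pose f : {scalar A} := HB.pack phi (GRing.isLinear.Build _ _ _ _ phi phi_lin).
have fE x : f x = phi x by [].
have f1 : f 1 = 1.
  (* Testing [g] at [1 + c i], where [c = g i], gives [1 + c^2 <= sqrt (1 + c^2)]. *)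
  have gi : g 'i%C%:A = 0.
    set c := g _; have := le_trans (gp0 ((1 +i* c) *: 1)) (p0_le _).
    rewrite (gc 1 c) g1 -/c bnorm_scalar mulr1 -expr2 => h.
    have : (1 + c ^+ 2) ^+ 2 <= 1 + c ^+ 2.
      have E : normc (1 +i* c) ^+ 2 = 1 + c ^+ 2 by rewrite sqr_normcE /= expr1n.
      by rewrite -[leRHS]E ler_sqr ?nnegrE ?normc_ge0 ?addr_ge0 ?sqr_ge0.
    have := sqr_ge0 c => h1 h2; apply/eqP; rewrite -sqrf_eq0; apply/eqP; nra.
  by rewrite fE /phi g1 gi oppr0.
have f_le x : normc (f x) <= bnorm x.
  have [->|fx0] := eqVneq (f x) 0; first by rewrite normc0 bnorm_ge0.
  (* A rotation making [f (c x)] real, so that it equals [g (c x)]. *)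
  pose c := (f x)^-1 * (normc (f x))%:C.
  have nf : 0 < normc (f x) by rewrite normc_gt0.
  have c1 : normc c = 1.
    by rewrite normcM normcV normcR gtr0_norm // mulVf // gt_eqF.
  have fc : f (c *: x) = (normc (f x))%:C.
    by rewrite linearZ /= /c mulrAC mulVf // mul1r.
  have -> : normc (f x) = g (c *: x) by move: fc; rewrite {1}fE => -[].
  by rewrite (le_trans (gp0 _)) // (le_trans (p0_le _)) // bnormZ c1 mul1r.
exists f; last first.
  move=> x Jx; rewrite fE /phi gJ // gJ ?oppr0 //; exact: JZ.
split=> //; apply: le_anti; apply/andP; split.
  apply: ge_ereal_sup => _ [x /= x1 <-]; rewrite lee_fin.
  exact: le_trans (f_le x) x1.
apply: ereal_sup_ubound; exists 1; first by rewrite /= bnorm1.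
by rewrite f1 normc1.
Qed.

(** A state vanishing on [x = z - a] takes the value [z] at [a]. If [x] has no left inverse, the
    left ideal [A x] contains no unit and so stays at distance [1] from the identity. Otherwise a
    unit in the right ideal [x A] would make [x] invertible, so [x A] serves instead. *)
Lemma spectrum_numerical_range (a : A) z : spectrum a z -> numerical_range a z.
Proof.
move=> /negP az; set x := z%:A - a in az.
suff [J [J0 JD JZ J1] Jx] : exists2 J : set A,
    [/\ J 0, forall x y, J x -> J y -> J (x + y),
     forall c x, J x -> J (c *: x) & forall x, J x -> 1 <= bnorm (1 + x)] & J x.
  have [phi phiS phiJ] := exists_state J0 JD JZ J1; exists phi => //.
  have := phiJ _ Jx; rewrite linearB linearZ /= phiS.2 mulr1 => /eqP.
  by rewrite subr_eq0 => /eqP.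
have unit1 w : bnorm (1 + w) < 1 -> w \is a GRing.unit.
  move=> /bnorm_lt1_unit; rewrite opprD addrA subrr add0r unitrN.
  by [].
have [[y yx]|nl] := pselect (exists y, y * x = 1); last first.
  exists [set y * x | y in setT]; last by exists 1 => //; rewrite mul1r.
  split=> [|_ _ [y _ <-] [y' _ <-]|c _ [y _ <-]|_ [y _ <-]].
  - by exists 0; rewrite ?mul0r.
  - by exists (y + y'); rewrite ?mulrDl.
  - by exists (c *: y); rewrite ?scalerAl.
  - rewrite leNgt; apply/negP => /unit1 U; apply: nl.
    by exists ((y * x)^-1 * y); rewrite -mulrA mulVr.
exists [set x * y | y in setT]; last by exists 1 => //; rewrite mulr1.
split=> [|_ _ [w _ <-] [w' _ <-]|c _ [w _ <-]|_ [w _ <-]].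
- by exists 0; rewrite ?mulr0.
- by exists (w + w'); rewrite ?mulrDr.
- by exists (c *: w); rewrite ?scalerAr.
- rewrite leNgt; apply/negP => /unit1 U; apply: az; apply/unitrP; exists y.
  split=> //; have xw : x * (w * (x * w)^-1) = 1 by rewrite mulrA mulrV.
  by have -> : y = w * (x * w)^-1 by rewrite -[LHS]mulr1 -xw (mulrA y x) yx mul1r.
Qed.

End HahnBanach.

(** * The scalar iteration *)

(* If [x ^ p / a = (1 + u) / (1 - u)], then a Halley step multiplies [x] by
   [(p - u) / (p + u)] and turns [u] into [residual_num p u / residual_den p u]. *)
Definition residual_num (T : nzRingType) (p : nat) (u : T) : T :=
  (1 + u) * (p%:R - u) ^+ p - (1 - u) * (p%:R + u) ^+ p.

Definition residual_den (T : nzRingType) (p : nat) (u : T) : T :=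
  (1 + u) * (p%:R - u) ^+ p + (1 - u) * (p%:R + u) ^+ p.

Section Schwarz.
Variable R : rcfType.
Implicit Types (u v x g s z a b : R[i]).

Lemma complex_ext a b :
  complex.Re a = complex.Re b -> complex.Im a = complex.Im b -> a = b.
Proof. by case: a b => [? ?] [? ?] /= -> ->. Qed.

Lemma Imc_div a b : complex.Im (a / b) =
  (complex.Im a * complex.Re b - complex.Re a * complex.Im b) / normc b ^+ 2.
Proof.
rewrite sqr_normcE; case: a b => [a1 a2] [b1 b2] /=.
by set n := b1 ^+ 2 + b2 ^+ 2; ring.
Qed.

Lemma Rec_div a b : complex.Re (a / b) =
  (complex.Re a * complex.Re b + complex.Im a * complex.Im b) / normc b ^+ 2.
Proof.
rewrite sqr_normcE; case: a b => [a1 a2] [b1 b2] /=.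
by set n := b1 ^+ 2 + b2 ^+ 2; ring.
Qed.

Lemma RecM_nat n a : complex.Re (n%:R * a) = n%:R * complex.Re a.
Proof. by case: a => a b; rewrite -(rmorph_nat (real_complex R)) /= mul0r subr0. Qed.

Lemma ImcM_nat n a : complex.Im (n%:R * a) = n%:R * complex.Im a.
Proof. by case: a => a b; rewrite -(rmorph_nat (real_complex R)) /= mul0r addr0. Qed.

Lemma RecD a b : complex.Re (a + b) = complex.Re a + complex.Re b.
Proof. by case: a b => [? ?] []. Qed.

Lemma ImcD a b : complex.Im (a + b) = complex.Im a + complex.Im b.
Proof. by case: a b => [? ?] []. Qed.

Lemma Rec_nat n : complex.Re (n%:R : R[i]) = n%:R.
Proof. by rewrite -(rmorph_nat (real_complex R)). Qed.

Lemma Imc_nat n : complex.Im (n%:R : R[i]) = 0.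
Proof. by rewrite -(rmorph_nat (real_complex R)). Qed.

Lemma Re_ge2 g : normc (g - 3) <= 1 -> 2 <= complex.Re g.
Proof.
move=> g3; have := Re_le_normc (g - 3).
have -> : complex.Re (g - 3) = complex.Re g - 3.
  by rewrite RecD -(rmorph_nat (real_complex R)) -rmorphN.
by rewrite ler_norml => /andP[]; lra.
Qed.

(* With [q = d + 1], [(1 + v) ^ q = E + v O] where
   [q E / O = 1 + (q^2 - 1) v^2 / g]; this [g] is the tail of Gauss' continued
   fraction of [q v / tanh (q artanh v)]. The recursion in [q] shows that [g]
   stays close to [3], with imaginary part of the sign of that of [v ^ 2]. *)
Lemma tanh_tail v d : d.+1%:R ^+ 2 * normc (v ^+ 2) <= 1 ->
  exists s g, [/\ s != 0, normc (g - 3) <= 1,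
    0 <= complex.Im (v ^+ 2) * complex.Im g,
    (1 + v) ^+ d.+1 =
      s * (g + (d.+1%:R ^+ 2 - 1) * v ^+ 2) + v * (d.+1%:R * s * g) &
    (1 - v) ^+ d.+1 =
      s * (g + (d.+1%:R ^+ 2 - 1) * v ^+ 2) - v * (d.+1%:R * s * g)].
Proof.
have three : (3 : R[i]) != 0 by rewrite pnatr_eq0.
elim: d => [|d IH] hx.
  exists 3^-1, 3; split; rewrite ?subrr ?normc0 ?invr_eq0 //.
  - by rewrite Imc_nat mulr0.
  - by field.
  - by field.
have xi0 := normc_ge0 (v ^+ 2); set xi := normc (v ^+ 2) in hx xi0 IH.
have [|s [g [s0 g3 img eP eM]]] := IH.
  apply: le_trans hx; rewrite ler_wpM2r // ler_pXn2r ?nnegrE ?ler0n //.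
  by rewrite ler_nat.
set x := v ^+ 2 in img eP eM xi xi0 hx IH *.
have d3E : d%:R + 3 = (d + 3)%:R :> R[i] by rewrite natrD.
have d0 : 0 <= d%:R :> R by rewrite ler0n.
have gd : d%:R + 2 <= normc (g + d%:R).
  have := ger_normcB (d%:R + 3) (3 - g); rewrite (normcBC 3 g).
  have -> : d%:R + 3 - (3 - g) = g + d%:R by ring.
  have -> : normc (d%:R + 3 : R[i]) = d%:R + 3 by rewrite d3E normc_nat natrD.
  move: g3; set k := normc (g - 3) => g3; lra.
have gdp : 0 < normc (g + d%:R) by apply: lt_le_trans gd; lra.
have gd0 : g + d%:R != 0 by rewrite -normc_gt0.
have d3 : (d%:R + 3 : R[i]) != 0 by rewrite d3E pnatr_eq0 addn3.
(* This gives [d (1 + (d + 3) xi) <= d + 2], which keeps the new [g] within distance [1] of [3]. *)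
have xi1 : (d%:R + 3) * (d%:R * xi) <= 2.
  move: hx; rewrite -!natr1; nra.
have x1 : complex.Re x <= 1.
  apply: le_trans (ler_norm _) _; apply: le_trans (Re_le_normc _) _.
  rewrite -/xi; move: hx; rewrite -!natr1; nra.
have g1 := Re_ge2 g3.
(* Multiplying by [1 + v] and by [1 - v] replaces the even and odd parts [E], [O] by [E + x O] and
   [E + O]; these two equations determine the new [s] and [g]. *)
exists (s * (g + d%:R) / (d%:R + 3)), ((d%:R + 3) * (g + d%:R * x) / (g + d%:R)).
split.
- by rewrite !mulf_neq0 ?invr_eq0.
- have -> : (d%:R + 3) * (g + d%:R * x) / (g + d%:R) - 3 =
      d%:R * ((g - 3) + (d%:R + 3) * x) / (g + d%:R) by field.
  rewrite !normcM normcV ler_pdivrMr // mul1r normc_nat.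
  apply: le_trans gd.
  have : normc (g - 3 + (d%:R + 3) * x : R[i]) <= 1 + (d%:R + 3) * xi.
    apply: le_trans (ler_normcD _ _) _; apply: lerD => //.
    by rewrite normcM d3E normc_nat natrD.
  move=> h; apply: le_trans (ler_wpM2l d0 h) _; nra.
- rewrite -mulrA d3E ImcM_nat Imc_div !ImcD !RecD ImcM_nat RecM_nat Imc_nat Rec_nat.
  rewrite addr0 mulrCA mulr_ge0 ?ler0n // mulrA divr_ge0 ?sqr_ge0 //.
  set x2 := complex.Im x in img *; set g2 := complex.Im g in img *.
  set xr := complex.Re x in x1 *; set gr := complex.Re g in g1 *.
  have -> : x2 * ((g2 + d%:R * x2) * (gr + d%:R) - (gr + d%:R * xr) * g2) =
    d%:R * ((1 - xr) * (x2 * g2)) + d%:R * (x2 ^+ 2 * (gr + d%:R)) by ring.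
  apply: addr_ge0; apply: mulr_ge0 => //; apply: mulr_ge0 => //.
  - by rewrite subr_ge0.
  - exact: sqr_ge0.
  - by lra.
- rewrite exprS eP /x -!natr1; field.
  by rewrite d3 gd0.
- rewrite exprS eM /x -!natr1; field.
  by rewrite d3 gd0.
Qed.

(** By [tanh_tail] the numerator is [k b u^3] and the denominator [k ((g - b) (1 - u^2) + b)], with
    [0 < b <= 1]. It remains to see that [(g - b) (1 - u^2)] has nonnegative real part, which
    follows from [Re g >= 2], [Re u^2 <= 1] and the sign condition on the imaginary parts. *)
Lemma residual_schwarz p u : (1 < p)%N -> normc u <= 1 ->
  residual_den p u != 0 /\
  normc (residual_num p u) <= normc u ^+ 3 * normc (residual_den p u).
Proof.
case: p => [//|d] p1 u1; have pn0 : (d.+1%:R : R[i]) != 0 by rewrite pnatr_eq0.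
have pr0 : 0 < d.+1%:R :> R by rewrite ltr0n.
pose v := u / d.+1%:R; have uE : u = d.+1%:R * v by rewrite mulrC divfK.
have [|s [g [s0 g3 img eP eM]]] := @tanh_tail v d.
  rewrite -(normc_nat R d.+1) -!normcX -normcM -exprMn -uE normcX.
  by rewrite exprn_ile1 ?normc_ge0.
pose b : R[i] := (d.+1%:R ^+ 2 - 1) / d.+1%:R ^+ 2.
pose br : R := (d.+1%:R ^+ 2 - 1) / d.+1%:R ^+ 2.
have bE : b = br%:C.
  by rewrite rmorphM fmorphV rmorphB !rmorphXn rmorph_nat.
have br0 : 0 < br.
  by rewrite divr_gt0 ?exprn_gt0 // subr_gt0 expr_gt1 ?ler0n // ltr1n.
have br1 : br <= 1.
  by rewrite ler_pdivrMr ?exprn_gt0 // mul1r gerBl.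
pose k : R[i] := 2 * d.+1%:R ^+ d.+1 * s.
have k0 : k != 0 by rewrite !mulf_neq0 ?expf_neq0 // pnatr_eq0.
have bz : b * u ^+ 2 = (d.+1%:R ^+ 2 - 1) * v ^+ 2.
  by rewrite uE exprMn mulrA divfK // expf_neq0.
have pP : (d.+1%:R + u) ^+ d.+1 = d.+1%:R ^+ d.+1 * (1 + v) ^+ d.+1.
  by rewrite -exprMn mulrDr mulr1 -uE.
have pM : (d.+1%:R - u) ^+ d.+1 = d.+1%:R ^+ d.+1 * (1 - v) ^+ d.+1.
  by rewrite -exprMn mulrBr mulr1 -uE.
have NE : residual_num d.+1 u = k * (b * u ^+ 3).
  have -> : b * u ^+ 3 = (d.+1%:R ^+ 2 - 1) * v ^+ 2 * u by rewrite -bz; ring.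
  rewrite /residual_num pP pM eP eM /k uE; ring.
have DE : residual_den d.+1 u = k * ((g - b) * (1 - u ^+ 2) + b).
  rewrite (_ : _ + b = g * (1 - u ^+ 2) + b * u ^+ 2); last by ring.
  by rewrite bz /residual_den pP pM eP eM /k uE; ring.
have g1 := Re_ge2 g3.
have lower : br <= normc ((g - b) * (1 - u ^+ 2) + b).
  apply: le_trans (le_trans (ler_norm _) (Re_le_normc _)).
  rewrite RecD {2}bE lerDr bE.
  have z1 : complex.Re (u ^+ 2) <= 1.
    apply: le_trans (ler_norm _) _; apply: le_trans (Re_le_normc _) _.
    by rewrite normcX exprn_ile1 ?normc_ge0.
  have : 0 <= complex.Im (u ^+ 2) * complex.Im g.
    rewrite uE exprMn -natrX ImcM_nat -mulrA mulr_ge0 ?ler0n //.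
  case: (u ^+ 2) z1 (g) g1 => [z1 z2] /= hz [gr gi] /= hg him.
  rewrite (_ : _ - _ = (gr - br) * (1 - z1) + z2 * gi); last by ring.
  by rewrite addr_ge0 // mulr_ge0 //; lra.
rewrite NE DE; split.
  by rewrite mulf_neq0 // -normc_gt0 (lt_le_trans br0).
rewrite (normcM k (b * _)) (normcM b) normcX (normcM k) {1}bE normcR.
rewrite gtr0_norm // [leRHS]mulrCA ler_wpM2l ?normc_ge0 //.
by rewrite mulrC ler_wpM2l // ?exprn_ge0 ?normc_ge0 // -bE.
Qed.

End Schwarz.

(** * The argument of the scalar iterates *)

Section Polar.
Variable R : realType.
Implicit Types (r s t : R) (u z w : R[i]).

Definition polar r t : R[i] := (r * cos t) +i* (r * sin t).

Lemma polarM r s t1 t2 : polar r t1 * polar s t2 = polar (r * s) (t1 + t2).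
Proof.
apply/eqP; rewrite eq_complex /= cosD sinD.
by apply/andP; split; apply/eqP; ring.
Qed.

Lemma polarX r t n : polar r t ^+ n = polar (r ^+ n) (n%:R * t).
Proof.
elim: n => [|n IH].
  by rewrite !expr0 mul0r /polar cos0 sin0 !mul1r.
by rewrite !exprS IH polarM -[in RHS]natr1 mulrDl mul1r [t + _]addrC.
Qed.

Lemma polarV r t : r != 0 -> (polar r t)^-1 = polar r^-1 (- t).
Proof.
move=> r0; have E : polar r t * polar r^-1 (- t) = 1.
  by rewrite polarM subrr divff // /polar cos0 sin0 mulr0 mulr1.
have p0 : polar r t != 0.
  by apply/eqP => p0; move/eqP: E; rewrite p0 mul0r eq_sym oner_eq0.
by apply: (mulfI p0); rewrite divff.
Qed.

Lemma normc_polar r t : 0 <= r -> normc (polar r t) = r.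
Proof.
move=> r0; rewrite /= !exprMn -mulrDr cos2Dsin2 mulr1 sqrtr_sqr.
exact: ger0_norm.
Qed.

(** Half-angle formula: the tangent of half the argument is [Im z / (Re z + |z|)]. *)
Lemma polar_halfplane z : 0 < complex.Re z ->
  z = polar (normc z) (2 * atan (complex.Im z / (complex.Re z + normc z))).
Proof.
move=> X0; have rE := sqr_normcE z; have r0 : 0 < normc z.
  by apply: lt_le_trans (Re_le_normc z); rewrite gtr0_norm.
move: (normc z) rE r0 => r; case: z X0 => X Y /= X0 rE r0.
set D := X + r; set tau := Y / D; have D0 : 0 < D by rewrite addr_gt0.
have YE : Y ^+ 2 = r ^+ 2 - X ^+ 2 by rewrite rE; ring.
have DE : D ^+ 2 + Y ^+ 2 = 2 * r * D by rewrite YE /D; ring.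
have t1 : 1 + tau ^+ 2 = 2 * r / D.
  apply: (@mulIf _ (D ^+ 2)); first by rewrite expf_neq0 // gt_eqF.
  rewrite -[RHS](mulrA _ D^-1) (_ : D^-1 * D ^+ 2 = D); last by field; rewrite gt_eqF.
  by rewrite -DE /tau; field; rewrite gt_eqF.
have c2 : cos (atan tau) ^+ 2 = D / (2 * r).
  by rewrite cos_atan exprVn sqr_sqrtr ?addr_ge0 ?sqr_ge0 // t1 invf_div.
have c0 : cos (atan tau) != 0.
  by rewrite cos_atan invr_eq0 gt_eqF // sqrtr_gt0 t1 divr_gt0 // mulr_gt0.
have sE : sin (atan tau) = tau * cos (atan tau).
  by apply: (mulIf (invr_neq0 c0)); rewrite mulfK //; exact: atanK.
rewrite /polar mulr_natl mulr2n cosD sinD sE.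
set c := cos _ in c2 *.
have rn : r != 0 by rewrite gt_eqF.
have Dn : D != 0 by rewrite gt_eqF.
apply/eqP; rewrite eq_complex /=; apply/andP; split; apply/eqP.
  rewrite (_ : c * c - _ = c ^+ 2 * (1 - tau ^+ 2)); last by ring.
  rewrite c2 (_ : r * _ = D * (1 - tau ^+ 2) / 2); last by field.
  apply: (@mulIf _ (2 * D)); first by rewrite mulf_neq0.
  have -> : D * (1 - tau ^+ 2) / 2 * (2 * D) = D ^+ 2 - Y ^+ 2.
    by rewrite /tau; field.
  by rewrite YE /D; ring.
rewrite (_ : _ + _ = 2 * tau * c ^+ 2); last by ring.
by rewrite c2 /tau; field; rewrite rn Dn.
Qed.

Lemma atan_le (s : R) : 0 <= s -> atan s <= s.
Proof.
move=> s0; have [->|sn] := eqVneq s 0; first by rewrite atan0.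
have sp : 0 < s by rewrite lt0r sn.
have [|c _] := @MVT R (@atan R) (fun x => (1 + x ^+ 2)^-1) 0 s sp.
  by apply: continuous_subspaceT => x; exact: continuous_atan.
rewrite atan0 !subr0 => ->; rewrite ler_piMl // invf_le1 ?lerDl ?sqr_ge0 //.
by rewrite ltr_wpDr // sqr_ge0.
Qed.

Lemma polar_right z : 0 < complex.Re z ->
  exists r t, [/\ 0 < r, `|t| < pi / 2 & z = polar r t].
Proof.
move=> z0; have nz : 0 < normc z.
  by apply: lt_le_trans (Re_le_normc z); rewrite gtr0_norm.
exists (normc z), (2 * atan (complex.Im z / (complex.Re z + normc z))); split=> //;
  last exact: polar_halfplane.
have D0 : 0 < complex.Re z + normc z by rewrite addr_gt0.
have : `|complex.Im z / (complex.Re z + normc z)| < 1.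
  rewrite normrM normfV [`|_ + _|]gtr0_norm // ltr_pdivrMr // mul1r.
  by apply: le_lt_trans (Im_le_normc z) _; rewrite ltrDr.
set tau := _ / _; rewrite ltr_norml => /andP[h1 h2].
have := lt_atan h2; have := lt_atan h1.
rewrite atanN !atan1 => k1 k2; rewrite ltr_norml; lra.
Qed.

(* [p |t| <= 2] because [t = 2 atan tau] with [p |tau| <= 1]. *)
Lemma polar_factor (p : nat) u : (1 < p)%N -> normc u <= 1 ->
  exists r t, [/\ 0 < r, p%:R * `|t| <= pi & (p%:R - u) / (p%:R + u) = polar r t].
Proof.
move=> p1 u1; have P2 : 2 <= p%:R :> R by rewrite ler_nat.
have pu : p%:R + u != 0.
  rewrite -normc_gt0; have := ger_normcB p%:R (- u).
  by rewrite opprK normcN normc_nat; lra.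
set n := normc (p%:R + u) ^+ 2; have n0 : 0 < n by rewrite exprn_gt0 // normc_gt0.
pose x := complex.Re u; pose y := complex.Im u.
have s1 : x ^+ 2 + y ^+ 2 <= 1 by rewrite -sqr_normcE exprn_ile1 ?normc_ge0.
have y1 : `|y| <= 1 by apply: le_trans (Im_le_normc u) u1.
(* [X + i Y] is [p - u] times the conjugate of [p + u], which has the same argument as the
   quotient. *)
pose X := p%:R ^+ 2 - (x ^+ 2 + y ^+ 2); pose Y := - (2 * p%:R * y).
pose z : R[i] := X +i* Y.
have zE : (p%:R - u) / (p%:R + u) = n^-1%:C * z.
  have reN : complex.Re (- u) = - x by rewrite /x; case: (u).
  have imN : complex.Im (- u) = - y by rewrite /y; case: (u).
  by apply: complex_ext; rewrite (Rec_div, Imc_div) -/n !(RecD, ImcD) (reN, imN)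
    Rec_nat Imc_nat -/x -/y /= /X /Y; ring.
have X0 : 0 < X by rewrite /X; nra.
have [rz0 rzE] : 0 < normc z /\ normc z ^+ 2 = X ^+ 2 + Y ^+ 2.
  split; last by rewrite sqr_normcE.
  by apply: lt_le_trans (Re_le_normc z); rewrite gtr0_norm.
exists (n^-1 * normc z), (2 * atan (Y / (X + normc z))); split.
- by rewrite mulr_gt0 // invr_gt0.
- have D0 : 0 < X + normc z by rewrite addr_gt0.
  have : p%:R * `|Y / (X + normc z)| <= 1.
    rewrite normrM normfV [`|X + _|]gtr0_norm // mulrA ler_pdivrMr // mul1r.
    have -> : `|Y| = 2 * p%:R * `|y|.
      by rewrite normrN normrM ger0_norm // mulr_ge0.
    have yE : y ^+ 2 = `|y| ^+ 2 by rewrite real_normK ?num_real.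
    have y0 := normr_ge0 y; set q := `|y| in y0 y1 yE *.
    rewrite -lerBlDl; have [h|h] := leP (p%:R * (2 * p%:R * q) - X) 0.
      by apply: le_trans h _; exact: ltW.
    (* After squaring, the claim reduces to [(p^2 - 1) q <= X], which follows from [q <= 1] and
       [x^2 + y^2 <= 1]. *)
    rewrite -(@ler_pXn2r _ 2) ?nnegrE ?(ltW h) ?(ltW rz0) // rzE.
    have -> : Y ^+ 2 = 4 * p%:R ^+ 2 * q ^+ 2 by rewrite -yE /Y; ring.
    have XP : (p%:R ^+ 2 - 1) * q <= X.
      have : 0 <= (p%:R ^+ 2 - 1) * (1 - q).
        by rewrite mulr_ge0 ?subr_ge0 // exprn_ege1 //; lra.
      rewrite /X; lra.
    have : 0 <= 4 * (p%:R ^+ 2 * q) * (X - (p%:R ^+ 2 - 1) * q).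
      by rewrite !mulr_ge0 ?sqr_ge0 ?subr_ge0.
    by lra.
  set tau := Y / _ => ht.
  have -> : `|2 * atan tau| = 2 * atan `|tau|.
    rewrite normrM ger0_norm //; congr (_ * _).
    have [t0|t0] := leP 0 tau.
      by have := le_atan t0; rewrite atan0 => h; rewrite !ger0_norm.
    by have := lt_atan t0; rewrite atan0 => h; rewrite !ltr0_norm // atanN.
  have := pi_ge2 R; have := ler_wpM2l (ler0n R p) (atan_le (normr_ge0 tau)); lra.
- rewrite zE (_ : polar _ _ = n^-1%:C * polar (normc z) (2 * atan (Y / (X + normc z)))).
    by congr (_ * _); exact: (@polar_halfplane z).
  by apply/eqP; rewrite eq_complex /=; apply/andP; split; apply/eqP; ring.
Qed.

Lemma cos_gt0_range s : `|s| < pi + pi / 2 -> 0 < cos s -> `|s| < pi / 2.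
Proof.
move=> hs; rewrite -cos_norm => c0; rewrite ltNge; apply/negP => h.
have : 0 <= cos (`|s| - pi) by apply: cos_ge0_pihalf; apply/andP; split; lra.
by have := cosDpi (`|s| - pi); rewrite subrK => e; lra.
Qed.

Lemma Re_gt0_normc w : (0 < complex.Re w) = (normc (w - 1) < normc (w + 1)).
Proof.
rewrite -[RHS](@ltr_pXn2r _ 2) ?nnegrE ?normc_ge0 // !sqr_normcE.
case: w => a b /=; rewrite subr0 addr0; apply/idP/idP; nra.
Qed.

Lemma cayley_Re z w : w + z != 0 -> z != 0 ->
  (0 < complex.Re (w / z)) = (normc ((w - z) / (w + z)) < 1).
Proof.
move=> wz z0; rewrite Re_gt0_normc.
have -> : w / z - 1 = (w - z) / z by field.
have -> : w / z + 1 = (w + z) / z by field.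
rewrite !normcM !normcV ltr_pM2r ?invr_gt0 ?normc_gt0 //.
by rewrite ltr_pdivrMr ?normc_gt0 // mul1r.
Qed.

(* [p t - b] is an argument of [x ^ p / z]. It moves by at most [pi] and its
   cosine stays positive, so it cannot leave the interval. *)
Lemma halley_step_polar (p : nat) (r0 b r t : R) :
  (1 < p)%N -> 0 < r0 -> 0 < r -> `|p%:R * t - b| < pi / 2 ->
  let z := polar r0 b in let x := polar r t in
  exists r' t', [/\ 0 < r', `|p%:R * t' - b| < pi / 2,
    p.+1%:R * x ^+ p + p.-1%:R * z != 0 &
    x * (p.-1%:R * x ^+ p + p.+1%:R * z) / (p.+1%:R * x ^+ p + p.-1%:R * z)
      = polar r' t'].
Proof.
move=> p1 r00 rp ht z x; have z0 : z != 0.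
  by rewrite -normc_gt0 normc_polar // ltW.
have wE s q : polar s q ^+ p / z = polar (s ^+ p / r0) (p%:R * q - b).
  by rewrite polarX polarV ?gt_eqF // polarM.
have w0 : 0 < complex.Re (x ^+ p / z).
  rewrite wE /= mulr_gt0 ?divr_gt0 ?exprn_gt0 //; apply: cos_gt0_pihalf.
  by rewrite -ltr_norml.
set w := x ^+ p in w0 *.
have S0 : w + z != 0.
  apply/eqP => e; have : w / z + 1 = 0 by rewrite -[1](divff z0) -mulrDl e mul0r.
  move/(congr1 (@complex.Re R)); rewrite RecD /= => h; move: w0; lra.
pose u := (w - z) / (w + z).
have u1 : normc u < 1 by rewrite -cayley_Re.
have [D0 ND] := residual_schwarz p1 (ltW u1).
have pE : p.+1%:R = p%:R + 1 :> R[i] by rewrite natr1.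
have pE' : p.-1%:R = p%:R - 1 :> R[i].
  by rewrite -{2}(ltn_predK p1) -natr1 addrK.
have denE : p.+1%:R * w + p.-1%:R * z = (w + z) * (p%:R + u).
  by rewrite /u pE pE'; field.
have numE : p.-1%:R * w + p.+1%:R * z = (w + z) * (p%:R - u).
  by rewrite /u pE pE'; field.
have pu : p%:R + u != 0.
  rewrite -normc_gt0; have := ger_normcB p%:R (- u).
  have : 2 <= p%:R :> R by rewrite ler_nat.
  by rewrite opprK normcN normc_nat; lra.
have [r1 [t1 [r10 pt1 fE]]] := polar_factor p1 (ltW u1).
have xE : x * (p.-1%:R * w + p.+1%:R * z) / (p.+1%:R * w + p.-1%:R * z)
    = polar (r * r1) (t + t1).
  rewrite -polarM -fE denE numE -/x; field.
  by rewrite S0 pu.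
exists (r * r1), (t + t1); split=> //; first exact: mulr_gt0.
  apply: cos_gt0_range.
    have -> : p%:R * (t + t1) - b = (p%:R * t - b) + p%:R * t1 by ring.
    apply: le_lt_trans (ler_normD _ _) _; rewrite [pi + _]addrC ltr_leD //.
    by rewrite normrM ger0_norm.
  (* The Cayley transform of the new quotient is [residual_num p u / residual_den p u], of modulus
     below [1] by [residual_schwarz]; hence the cosine is positive. *)
  have : 0 < complex.Re (polar (r * r1) (t + t1) ^+ p / z).
    have wE2 : w = (w + z) / 2 * (1 + u) by rewrite /u; field.
    have zE2 : z = (w + z) / 2 * (1 - u) by rewrite /u; field.
    have xpE : polar (r * r1) (t + t1) ^+ p = w * ((p%:R - u) / (p%:R + u)) ^+ p.
      by rewrite -polarM -fE exprMn.
    have k0 : (w + z) / 2 / (p%:R + u) ^+ p != 0.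
      by rewrite !mulf_neq0 ?invr_eq0 ?expf_neq0 // pnatr_eq0.
    have pup : (p%:R + u) ^+ p != 0 by rewrite expf_neq0.
    have two : (2 : R[i]) != 0 by rewrite pnatr_eq0.
    have sE : polar (r * r1) (t + t1) ^+ p + z =
        (w + z) / 2 / (p%:R + u) ^+ p * residual_den p u.
      rewrite xpE {1}wE2 {2}zE2 /residual_den expr_div_n; field.
      by rewrite pup.
    have dE : polar (r * r1) (t + t1) ^+ p - z =
        (w + z) / 2 / (p%:R + u) ^+ p * residual_num p u.
      rewrite xpE {1}wE2 {2}zE2 /residual_num expr_div_n; field.
      by rewrite pup.
    have sN : polar (r * r1) (t + t1) ^+ p + z != 0 by rewrite sE mulf_neq0.
    rewrite (cayley_Re sN z0) dE sE -mulf_div divff // mul1r.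
    rewrite normcM normcV ltr_pdivrMr ?normc_gt0 // mul1r.
    apply: le_lt_trans ND _; rewrite gtr_pMl ?normc_gt0 //.
    by rewrite exprn_ilt1 ?normc_ge0.
  rewrite wE /= pmulr_rgt0 // divr_gt0 ?exprn_gt0 ?mulr_gt0 //.
by rewrite denE mulf_neq0.
Qed.

End Polar.

(** * The open sector as a sign condition *)

Section Sector.
Variables (R : realType) (theta : R).
Hypotheses (theta0 : 0 < theta) (theta_pihalf : theta <= pi / 2).
Implicit Types (z w : R[i]) (r t : R).

(** At [z = r e^(i t)] with [|t| <= pi] this is [r sin (theta - |t|)]: a Lipschitz function that is
    positive exactly in the interior of the sector. *)
Definition sector_gap z : R :=
  complex.Re z * sin theta - `|complex.Im z| * cos theta.

Let sin_theta_gt0 : 0 < sin theta.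
Proof.
apply: sin_gt0_pi.
have pi0 := pi_gt0 R; have th0 := theta0; have th2 := theta_pihalf.
by apply/andP; split; lra.
Qed.

Let cos_theta_ge0 : 0 <= cos theta.
Proof.
apply: cos_ge0_pihalf.
have pi0 := pi_gt0 R; have th0 := theta0; have th2 := theta_pihalf.
by apply/andP; split; lra.
Qed.

Lemma sector_gap_ge0 z : sector theta z -> 0 <= sector_gap z.
Proof.
have th0 := theta0; have th2 := theta_pihalf; have pi0 := pi_gt0 R.
move=> [r [t [r0]]]; rewrite ler_norml => /andP[t1 t2] ->; rewrite /sector_gap /=.
rewrite normrM ger0_norm // -!mulrA -mulrBr mulr_ge0 //.
have [s0|s0] := leP 0 (sin t).
  rewrite (_ : _ - _ = sin (theta - t)); last by rewrite sinB ger0_norm //; ring.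
  by apply: sin_ge0_pi; apply/andP; split; lra.
rewrite (_ : _ - _ = sin (theta + t)); last by rewrite sinD ltr0_norm //; ring.
by apply: sin_ge0_pi; apply/andP; split; lra.
Qed.

Lemma sector_gap_gt0_polar z : 0 < sector_gap z ->
  exists r t, [/\ 0 < r, `|t| < theta & z = polar r t].
Proof.
move=> gz; have z0 : 0 < complex.Re z.
  rewrite -(pmulr_lgt0 _ sin_theta_gt0).
  have : 0 <= `|complex.Im z| * cos theta by rewrite mulr_ge0.
  by move: gz; rewrite /sector_gap; lra.
have [r [t [r0 t0 zE]]] := polar_right z0; exists r, t; split=> //.
move: gz; rewrite zE /sector_gap /= normrM gtr0_norm // -!mulrA -mulrBr.
rewrite pmulr_rgt0 // subr_gt0 => h; rewrite ltNge; apply/negP => tt.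
have pi0 := pi_gt0 R; have th0 := theta0; have th2 := theta_pihalf.
move: t0; rewrite ltr_norml => /andP[t1 t2].
have : cos t * sin theta <= `|sin t| * cos theta; last by rewrite leNgt h.
have [t0|t0] := leP 0 t.
  rewrite (ger0_norm t0) in tt; apply: le_trans (ler_wpM2r cos_theta_ge0 (ler_norm _)).
  rewrite -subr_ge0 -sinB; apply: sin_ge0_pi; apply/andP; split; lra.
rewrite (ltr0_norm t0) in tt.
rewrite -normrN -sinN -(cosN t).
apply: le_trans (ler_wpM2r cos_theta_ge0 (ler_norm _)).
by rewrite -subr_ge0 -sinB; apply: sin_ge0_pi; apply/andP; split; lra.
Qed.

Lemma sector_gap_lipschitz z w : sector_gap z - sector_gap w <= 2 * normc (z - w).
Proof.
have := Re_le_normc (z - w); have := Im_le_normc (z - w).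
have -> : complex.Re (z - w) = complex.Re z - complex.Re w by case: z w => [? ?] [].
have -> : complex.Im (z - w) = complex.Im z - complex.Im w by case: z w => [? ?] [].
move=> h1 h2; have c1 := cos_le1 theta; have s1 := sin_le1 theta.
have h3 : `|complex.Im w| - `|complex.Im z| <= normc (z - w).
  by apply: le_trans (lerB_dist _ _) _; rewrite distrC.
have h4 : complex.Re z - complex.Re w <= normc (z - w).
  by apply: le_trans (ler_norm _) _.
have n0 := normc_ge0 (z - w).
have h5 : (`|complex.Im w| - `|complex.Im z|) * cos theta <= normc (z - w).
  by apply: le_trans (ler_wpM2r cos_theta_ge0 h3) _; rewrite ler_piMr.
have h6 : (complex.Re z - complex.Re w) * sin theta <= normc (z - w).
  by apply: le_trans (ler_wpM2r (ltW sin_theta_gt0) h4) _; rewrite ler_piMr.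
by rewrite /sector_gap; lra.
Qed.

Lemma interior_sectorE z : interior (sector theta) z <-> 0 < sector_gap z.
Proof.
split=> [/nbhs_ballP[e /= e0 he]|gz].
  (* The radius of a ball in [R[i]] is a complex number, and its positivity says that it is real.
     The point [d] to the left of [z] is still in the sector, while moving left by [d] costs
     [d sin theta] of the gap. *)
  have [i0 r0] : complex.Im e = 0 /\ 0 < complex.Re e.
    by move: e0; rewrite ltcE /= => /andP[/eqP].
  have eE : e = (complex.Re e)%:C by case: (e) i0 => a b /= ->.
  pose d := complex.Re e / 2; have d0 : 0 < d by rewrite divr_gt0.
  have : sector theta (z - d%:C).
    apply: he; rewrite /ball /= opprB addrC subrK normr_normc normcR eE ltcR.
    by rewrite gtr0_norm // /d; lra.
  move=> /sector_gap_ge0.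
  have -> : sector_gap (z - d%:C) = sector_gap z - d * sin theta.
    by rewrite /sector_gap; case: (z) => a b /=; rewrite subr0; ring.
  have : 0 < d * sin theta by rewrite mulr_gt0.
  lra.
apply/nbhs_ballP; exists (sector_gap z / 2)%:C => /=.
  by rewrite ltcR divr_gt0.
move=> w; rewrite /ball /= normr_normc ltcR => hw.
have [|r [t [r0 t0 ->]]] := @sector_gap_gt0_polar w.
  by have := sector_gap_lipschitz z w; lra.
by exists r, t; split=> //; exact: ltW.
Qed.

Lemma sector_gap_eq0 z : 0 <= complex.Re z -> sector_gap z = 0 ->
  exists r t, [/\ 0 <= r, `|t| = theta & z = polar r t].
Proof.
move=> z0 gz; have gE : complex.Re z * sin theta = `|complex.Im z| * cos theta.
  by move: gz; rewrite /sector_gap; lra.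
have cs := cos2Dsin2 theta.
pose r := complex.Re z * cos theta + `|complex.Im z| * sin theta.
have r0 : 0 <= r by rewrite addr_ge0 ?mulr_ge0 // ltW.
have rc : r * cos theta = complex.Re z.
  rewrite -[RHS]mulr1 -cs /r mulrDl mulrDr; congr (_ + _); first by ring.
  by rewrite mulrAC -gE; ring.
have rs : r * sin theta = `|complex.Im z|.
  rewrite -[RHS]mulr1 -cs /r mulrDl mulrDr; congr (_ + _); last by ring.
  by rewrite mulrAC gE; ring.
have [i0|i0] := leP 0 (complex.Im z).
  exists r, theta; split; rewrite ?gtr0_norm //.
  by apply: complex_ext; rewrite /= ?rc ?rs ?ger0_norm.
exists r, (- theta); split; rewrite ?normrN ?gtr0_norm //.
by apply: complex_ext; rewrite /= ?cosN ?sinN ?mulrN ?rc ?rs ?ltr0_norm ?opprK.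
Qed.

End Sector.

Lemma pi_div_bounds (R : realType) p : (1 < p)%N ->
  0 < pi / p%:R :> R /\ pi / p%:R <= pi / 2 :> R.
Proof.
move=> p1; have P2 : 2 <= p%:R :> R by rewrite ler_nat.
split; first by rewrite divr_gt0 ?pi_gt0 //; lra.
by rewrite ler_pM2l ?pi_gt0 // lef_pV2 // posrE; lra.
Qed.

(** On the boundary the argument is [pi / p] up to sign, so [z ^ p] is real and nonpositive. *)
Lemma sector_gap_root (R : realType) p (z : R[i]) : (1 < p)%N ->
  0 <= sector_gap (pi / p%:R) z -> 0 < complex.Re (z ^+ p) ->
  0 < sector_gap (pi / p%:R) z.
Proof.
move=> p1; have [t0 t2] := pi_div_bounds R p1.
rewrite le_eqVlt => /predU1P[/esym gz zp|//]; exfalso.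
have cos0 : 0 <= cos (pi / p%:R : R).
  by apply: cos_ge0_pihalf; have pi0 := pi_gt0 R; apply/andP; split; lra.
have sin0 : 0 < sin (pi / p%:R : R).
  by apply: sin_gt0_pi; have pi0 := pi_gt0 R; apply/andP; split; lra.
have z0 : 0 <= complex.Re z.
  rewrite -(pmulr_lge0 _ sin0).
  have : 0 <= `|complex.Im z| * cos (pi / p%:R) by rewrite mulr_ge0.
  by move: gz; rewrite /sector_gap; lra.
have [r [t [r0 tE zE]]] := sector_gap_eq0 t0 t2 z0 gz.
have pn : p%:R != 0 :> R by rewrite pnatr_eq0 -lt0n ltnW.
move: zp; rewrite zE polarX /= -cos_norm normrM tE ger0_norm ?ler0n //.
rewrite mulrCA divff // mulr1 cospi mulrN1 oppr_gt0 ltNge exprn_ge0 //.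
Qed.

(** The arguments of [z] and [c z] differ by less than [2 pi / p], and [p] times the difference is a
    multiple of [2 pi]. *)
Lemma sector_root_inj (R : realType) p (z c : R[i]) : (1 < p)%N -> c ^+ p = 1 ->
  0 < sector_gap (pi / p%:R) z -> 0 < sector_gap (pi / p%:R) (c * z) -> c = 1.
Proof.
move=> p1 cp gz gcz; have [t0 t2] := pi_div_bounds R p1.
have [r [s [r0 hs zE]]] := sector_gap_gt0_polar t0 t2 gz.
have [r' [t [r'0 ht czE]]] := sector_gap_gt0_polar t0 t2 gcz.
have c1 : normc c = 1.
  apply/eqP; rewrite -(@pexpr_eq1 _ _ p) ?normc_ge0 ?(ltnW p1) //.
  by rewrite -normcX cp normc1.
have rr : r' = r.
  rewrite -(normc_polar t (ltW r'0)) -(normc_polar s (ltW r0)) -czE -zE.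
  by rewrite normcM c1 mul1r.
have p0 : 0 < p%:R :> R by rewrite ltr0n ltnW.
have : polar (r ^+ p) (p%:R * t) = polar (r ^+ p) (p%:R * s).
  by rewrite -!polarX -zE -{1}rr -czE exprMn cp mul1r.
case=> /(mulfI (lt0r_neq0 (exprn_gt0 p r0))) hc.
move=> /(mulfI (lt0r_neq0 (exprn_gt0 p r0))) hsn.
pose d := p%:R * (t - s) / 2.
have cd : cos (d *+ 2) = 1.
  have -> : d *+ 2 = p%:R * t - p%:R * s by rewrite /d; field.
  by rewrite cosB hc hsn -!expr2 cos2Dsin2.
have sd : sin d = 0.
  by apply/eqP; rewrite -sqrf_eq0 sin2cos2; move: cd; rewrite cos_mulr2n => h; apply/eqP; lra.
have dp : `|d| < pi.
  rewrite /d !normrM normfV [`|p%:R|]ger0_norm // [`|2|]ger0_norm //.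
  have : p%:R * `|t - s| < p%:R * (2 * (pi / p%:R)).
    by rewrite ltr_pM2l //; apply: le_lt_trans (ler_normB _ _) _; lra.
  have -> : p%:R * (2 * (pi / p%:R)) = 2 * pi :> R by field; rewrite gt_eqF.
  lra.
have d0 : d = 0.
  apply: contra_eq sd => dn; have n0 : 0 < `|d| by rewrite normr_gt0.
  have : 0 < sin `|d| by apply: sin_gt0_pi; rewrite n0.
  have [h|h] := leP 0 d; first by rewrite ger0_norm // => /lt0r_neq0.
  by rewrite ltr0_norm // sinN oppr_gt0 => /ltr0_neq0.
have ts : t = s.
  by move/eqP: d0; rewrite /d !mulf_eq0 invr_eq0 gt_eqF //= pnatr_eq0 orbF subr_eq0 => /eqP.
have z0 : z != 0 by rewrite zE -normc_gt0 normc_polar ?(ltW r0).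
by apply: (mulIf z0); rewrite mul1r czE rr ts -zE.
Qed.

Section HalleyFraction.
Variables (R : realType) (p : nat).
Hypothesis p1 : (1 < p)%N.

(** Numerator and denominator of [X_k] with ['X] in place of [a]: the Halley step at [P / Q],
    cleared of denominators by [Q ^ p] and not reduced. *)
Fixpoint halley_frac (k : nat) : {poly R[i]} * {poly R[i]} :=
  if k is k'.+1 then
    let: (P, Q) := halley_frac k' in
    (P * (p.-1%:R * P ^+ p + p.+1%:R * 'X * Q ^+ p),
     Q * (p.+1%:R * P ^+ p + p.-1%:R * 'X * Q ^+ p))
  else (1, 1).

Lemma halley_frac_sector z k : 0 < complex.Re z ->
  (halley_frac k).2.[z] != 0 /\
  sector (pi / p%:R) ((halley_frac k).1.[z] / (halley_frac k).2.[z]).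
Proof.
move=> /polar_right[r0 [b [r00 hb zE]]].
have p0 : 0 < p%:R :> R by rewrite ltr0n ltnW.
(* The inductive invariant is stronger than the sector: [p t] stays within [pi / 2] of [b], and
   [|b| < pi / 2], so [p |t| < pi]. *)
suff [Q0 [r [t [r1 ht E]]]] : (halley_frac k).2.[z] != 0 /\ exists r t,
    [/\ 0 < r, `|p%:R * t - b| < pi / 2 &
     (halley_frac k).1.[z] / (halley_frac k).2.[z] = polar r t].
  split=> //; exists r, t; split=> //; first exact: ltW.
  rewrite ler_pdivlMr // mulrC -[p%:R]ger0_norm ?ler0n // -normrM.
  have := ler_normD (p%:R * t - b) b; rewrite subrK; lra.
elim: k => [|k [Q0 [r [t [r1 ht E]]]]].
  rewrite /= !hornerC oner_eq0; split=> //; exists 1, 0; split=> //.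
    by rewrite mulr0 sub0r normrN.
  by rewrite /polar cos0 sin0 mulr0 mulr1 divr1.
have [r' [t' [r'0 ht' D0 xE]]] := halley_step_polar p1 r00 r1 ht.
rewrite -zE -E /= in D0 xE; rewrite /=.
case: (halley_frac k) Q0 E D0 xE => P Q /= Q0 E D0 xE.
rewrite !(hornerM, hornerD, horner_exp, hornerX) -!polyC_natr !hornerC.
set x := P.[z] in E D0 xE *; set y := Q.[z] in Q0 E D0 xE *.
have yp : y ^+ p != 0 by rewrite expf_neq0.
have den : p.+1%:R * x ^+ p + p.-1%:R * z * y ^+ p =
    y ^+ p * (p.+1%:R * (x / y) ^+ p + p.-1%:R * z).
  by rewrite expr_div_n; field.
have num : p.-1%:R * x ^+ p + p.+1%:R * z * y ^+ p =
    y ^+ p * (p.-1%:R * (x / y) ^+ p + p.+1%:R * z).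
  by rewrite expr_div_n; field.
rewrite den num; split; first by rewrite !mulf_neq0.
exists r', t'; split=> //; rewrite -xE.
by move: D0; set d := _ + _ => D0; field; rewrite D0 Q0 yp.
Qed.

End HalleyFraction.

(** * The iteration in the algebra *)

Section Bicommutant.
Variables (R : realType) (A : unitalBanachAlgType R) (a : A).
Implicit Types (x y : A).

(** Membership in the bicommutant of [a]. Mere commutation with [a] would not make two such elements
    commute with each other. *)
Definition bicommutes x := forall y, GRing.comm y a -> GRing.comm y x.

Lemma bicommutes_nat n : bicommutes n%:R.
Proof. by move=> y _; exact: commr_nat. Qed.

Lemma bicommutes1 : bicommutes 1.
Proof. by move=> y _; exact: commr1. Qed.

Lemma bicommutesD x y : bicommutes x -> bicommutes y -> bicommutes (x + y).
Proof. by move=> hx hy z za; apply: commrD; [exact: hx|exact: hy]. Qed.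

Lemma bicommutesB x y : bicommutes x -> bicommutes y -> bicommutes (x - y).
Proof. by move=> hx hy z za; apply: commrB; [exact: hx|exact: hy]. Qed.

Lemma bicommutesM x y : bicommutes x -> bicommutes y -> bicommutes (x * y).
Proof. by move=> hx hy z za; apply: commrM; [exact: hx|exact: hy]. Qed.

Lemma bicommutesX x n : bicommutes x -> bicommutes (x ^+ n).
Proof. by move=> hx z za; apply: commrX; exact: hx. Qed.

Lemma bicommutesV x : bicommutes x -> bicommutes x^-1.
Proof. by move=> hx z za; apply: commrV; exact: hx. Qed.

Lemma bicommutes_comm x y : bicommutes x -> bicommutes y -> GRing.comm x y.
Proof. by move=> hx hy; apply: hy; apply/commr_sym/hx. Qed.

Lemma bicommutes_cvg (u : nat -> A) l :
  (forall n, bicommutes (u n)) -> norm_cvg u l -> bicommutes l.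
Proof.
move=> hu ul y ya; apply: (bnorm_cvg_unique (u := fun n => y * u n)).
  exact: bnorm_cvgM (bnorm_cvg_cst _) ul.
apply: eq_bnorm_cvg (bnorm_cvgM ul (bnorm_cvg_cst y)) => n.
by rewrite (hu n y ya).
Qed.

End Bicommutant.

Section Residual.
Variables (R : realType) (A : unitalBanachAlgType R) (p : nat).
Hypothesis p1 : (1 < p)%N.
Implicit Types (u : A) (z : R[i]).

Lemma horner_residual_num z : (residual_num p 'X : {poly R[i]}).[z] = residual_num p z.
Proof.
rewrite /residual_num !(hornerE, horner_exp) -!polyC_natr !hornerC //.
Qed.

Lemma horner_residual_den z : (residual_den p 'X : {poly R[i]}).[z] = residual_den p z.
Proof.
rewrite /residual_den !(hornerE, horner_exp) -!polyC_natr !hornerC //.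
Qed.

Lemma horner_alg_residual_num u : horner_alg u (residual_num p 'X) = residual_num p u.
Proof.
by rewrite /residual_num !(rmorphB, rmorphD, rmorphM, rmorphXn) /= !rmorph1
  !rmorph_nat !horner_algX.
Qed.

Lemma horner_alg_residual_den u : horner_alg u (residual_den p 'X) = residual_den p u.
Proof.
by rewrite /residual_den !(rmorphB, rmorphD, rmorphM, rmorphXn) /= !rmorph1
  !rmorph_nat !horner_algX.
Qed.

Lemma residual_den_unit u :
  (forall z, spectrum u z -> normc z <= 1) -> residual_den p u \is a GRing.unit.
Proof.
move=> hu; rewrite -horner_alg_residual_den; apply: horner_alg_unit.
  apply/eqP => e; have [|+ _] := @residual_schwarz R p 0 p1; first by rewrite normc0.
  by rewrite -horner_residual_den e horner0 eqxx.
move=> z /rootP; rewrite horner_residual_den => z0; apply: spectrumNP => /hu z1.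
by have [] := residual_schwarz p1 z1; rewrite z0 eqxx.
Qed.

Lemma spectrum_residual u (rho : R) : 0 <= rho <= 1 ->
  (forall z, spectrum u z -> normc z <= rho) ->
  forall z, spectrum (residual_num p u / residual_den p u) z -> normc z <= rho ^+ 3.
Proof.
move=> /andP[r0 r1] hu l; rewrite -horner_alg_residual_num -horner_alg_residual_den.
have hu1 z : spectrum u z -> normc z <= 1 by move=> /hu /le_trans; apply.
move=> /spectrum_fraction[|z zu]; first by rewrite horner_alg_residual_den residual_den_unit.
rewrite horner_residual_num horner_residual_den => e.
have [D0] := residual_schwarz p1 (hu1 z zu); rewrite e normcM.
rewrite ler_pM2r ?normc_gt0 // => /le_trans; apply.
by rewrite lerXn2r ?nnegrE ?normc_ge0 // hu.
Qed.

Lemma natr_pm_unit u : (forall z, spectrum u z -> normc z <= 1) ->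
  (p%:R + u \is a GRing.unit) /\ (p%:R - u \is a GRing.unit).
Proof.
move=> hu; have P : 1 < p%:R :> R by rewrite ltr1n.
have E : p%:R = (p%:R : R[i])%:A :> A by rewrite scaler_nat.
split; last first.
  by rewrite E; apply: spectrumNP => /hu; rewrite normc_nat leNgt P.
rewrite -unitrN opprD E -scaleNr; apply: spectrumNP => /hu.
by rewrite normcN normc_nat leNgt P.
Qed.

End Residual.

Section HalleyStep.
Variables (R : realType) (A : unitalBanachAlgType R) (p : nat) (a : A).
Hypothesis p1 : (1 < p)%N.
Implicit Types (x u : A).

Definition cayley x : A := (x ^+ p - a) / (x ^+ p + a).

Definition halley_map x : A := x * (halley_num p a x / halley_den p a x).

Lemma bicommutes_halley_map x : bicommutes a x -> bicommutes a (halley_map x).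
Proof.
move=> hx; rewrite /halley_map /halley_num /halley_den.
have hs : bicommutes a a by [].
  have hn n : bicommutes a n%:R by exact: bicommutes_nat.
by do ![exact: hx|exact: hs|exact: hn|apply: bicommutesM|apply: bicommutesD
  |apply: bicommutesV|apply: bicommutesX].
Qed.

Lemma bicommutes_cayley x : bicommutes a x -> bicommutes a (cayley x).
Proof.
move=> hx; have hs : bicommutes a a by [].
by do ![exact: hx|exact: hs|apply: bicommutesM|apply: bicommutesB|apply: bicommutesD
  |apply: bicommutesV|apply: bicommutesX].
Qed.

(** With [S = x ^ p + a] and [u] the Cayley transform, [2 x ^ p = S (1 + u)] and [2 a = S (1 - u)];
    substitution makes the correction factor and the new transform rational in [u] alone. *)
Lemma halley_mapP x : bicommutes a x -> x ^+ p + a \is a GRing.unit ->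
  (forall z, spectrum (cayley x) z -> normc z <= 1) ->
  [/\ halley_den p a x \is a GRing.unit,
      halley_map x = x * ((p%:R - cayley x) / (p%:R + cayley x)),
      (halley_map x) ^+ p + a \is a GRing.unit &
      cayley (halley_map x) =
        residual_num p (cayley x) / residual_den p (cayley x)].
Proof.
move=> hx SU hu; set u := cayley x in hu *; set S := x ^+ p + a in SU.
have [puU muU] := natr_pm_unit p1 hu; have DU := residual_den_unit p1 hu.
have hs : bicommutes a a by [].
  have hn n : bicommutes a n%:R by exact: bicommutes_nat.
have h1 : bicommutes a 1 by exact: bicommutes1.
have bu : bicommutes a u := bicommutes_cayley hx.
have bS : bicommutes a S by apply: bicommutesD => //; exact: bicommutesX.
have Su : S * u = x ^+ p - a.
  rewrite /u /cayley -/S; have bxa : bicommutes a (x ^+ p - a).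
    by apply: bicommutesB => //; exact: bicommutesX.
  by rewrite mulrA (bicommutes_comm bS bxa) mulrK.
have wE : 2%:R * x ^+ p = S * (1 + u).
  by rewrite mulrDr mulr1 Su /S addrACA subrr addr0 mulr_natl mulr2n.
have aE : 2%:R * a = S * (1 - u).
  by rewrite mulrBr mulr1 Su /S opprB [x ^+ p + a]addrC addrACA subrr addr0 mulr_natl mulr2n.
have pE : p.+1%:R = p%:R + 1 :> A by rewrite natr1.
have pE' : p.-1%:R = p%:R - 1 :> A.
  by rewrite -{2}(ltn_predK p1) -natr1 addrK.
have denE : halley_den p a x = S * (p%:R + u).
  rewrite /halley_den pE pE' mulrDl mulrBl !mul1r addrACA -mulrDr -/S -Su.
  by rewrite [RHS]mulrDr (commr_nat S p).
have numE : halley_num p a x = S * (p%:R - u).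
  rewrite /halley_num pE pE' mulrBl mulrDl !mul1r addrACA -mulrDr -/S.
  by rewrite [RHS]mulrBr (commr_nat S p) Su opprB; congr (_ + _); rewrite addrC.
have bpu : bicommutes a (p%:R + u) by exact: bicommutesD.
have bmu : bicommutes a (p%:R - u) by exact: bicommutesB.
have xE : halley_map x = x * ((p%:R - u) / (p%:R + u)).
  rewrite /halley_map numE denE; congr (_ * _).
  rewrite (bicommutes_comm bS bmu) (bicommutes_comm bS bpu) invrM // mulrA.
  by rewrite mulrK.
set x' := halley_map x in xE *; pose q := (p%:R + u) ^+ p.
have qU : q \is a GRing.unit by rewrite unitrX.
have bq : bicommutes a q by exact: bicommutesX.
have xq : x' ^+ p * q = x ^+ p * (p%:R - u) ^+ p.
  rewrite xE exprMn_comm; last first.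
    by apply: (bicommutes_comm hx); apply: bicommutesM => //; exact: bicommutesV.
  rewrite -mulrA; congr (_ * _); rewrite exprMn_comm; last first.
    by apply: (bicommutes_comm bmu); exact: bicommutesV.
  by rewrite -mulrA -exprMn_comm ?mulVr ?expr1n ?mulr1 // /GRing.comm mulVr // mulrV.
have SE : 2%:R * (x' ^+ p + a) * q = S * residual_den p u.
  rewrite -mulrA [(_ + a) * q]mulrDl xq mulrDr !mulrA wE aE /residual_den [RHS]mulrDr !mulrA.
  by [].
have NE : 2%:R * (x' ^+ p - a) * q = S * residual_num p u.
  rewrite -mulrA [(_ - a) * q]mulrBl xq mulrBr !mulrA wE aE /residual_num [RHS]mulrBr !mulrA.
  by [].
have twoU : (2%:R : A) \is a GRing.unit.
  have -> : 2%:R = (2%:R : R[i])%:A :> A by rewrite scaler_nat.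
  by apply: (@scale_neq0_unit R A); rewrite ?unitr1 // pnatr_eq0.
have S'U : x' ^+ p + a \is a GRing.unit.
  have : 2%:R * (x' ^+ p + a) * q \is a GRing.unit by rewrite SE unitrMl.
  by rewrite unitrMl // unitrMr.
split=> //; first by rewrite denE unitrMl.
have bx' : bicommutes a x' by exact: bicommutes_halley_map.
have bu' := bicommutes_cayley bx'; set u' := cayley x' in bu' *.
have u'S : u' * (x' ^+ p + a) = x' ^+ p - a by rewrite /u' /cayley divrK.
have bD : bicommutes a (residual_den p u).
  by apply: bicommutesD; apply: bicommutesM; (exact: bicommutesD || exact: bicommutesB
    || exact: bicommutesX).
clearbody u'; apply: (mulIr DU); rewrite divrK //; apply: (mulrI SU).
rewrite mulrA (bicommutes_comm bS bu') -mulrA -SE -NE -u'S !mulrA.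
by rewrite (commr_nat u' 2).
Qed.

End HalleyStep.

(** * Contraction in an adapted seminorm *)

Section OperatorBound.
Variables (R : realType) (A : unitalBanachAlgType R).
Implicit Types (x y : A) (nu : A -> R) (c d : R).

Definition is_seminorm nu := [/\ forall x, 0 <= nu x,
  forall x y, nu (x + y) <= nu x + nu y &
  forall (k : R[i]) x, nu (k *: x) = normc k * nu x].

(** A bound on left multiplication by [y]; it composes well although [nu] is not assumed
    submultiplicative. *)
Definition op_bound nu y c := forall x, nu (y * x) <= c * nu x.

Lemma op_boundD nu y1 y2 c1 c2 : is_seminorm nu ->
  op_bound nu y1 c1 -> op_bound nu y2 c2 -> op_bound nu (y1 + y2) (c1 + c2).
Proof.
by case=> _ nD _ h1 h2 x; rewrite mulrDl mulrDl (le_trans (nD _ _)) // lerD.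
Qed.

Lemma op_boundM nu y1 y2 c1 c2 : 0 <= c1 ->
  op_bound nu y1 c1 -> op_bound nu y2 c2 -> op_bound nu (y1 * y2) (c1 * c2).
Proof.
by move=> c0 h1 h2 x; rewrite -!mulrA (le_trans (h1 _)) // ler_wpM2l.
Qed.

Lemma op_bound_scalar nu (k : R[i]) : is_seminorm nu -> op_bound nu k%:A (normc k).
Proof. by case=> _ _ nZ x; rewrite mulr_algl nZ. Qed.

Lemma op_bound_le nu y c d : is_seminorm nu -> c <= d ->
  op_bound nu y c -> op_bound nu y d.
Proof. by case=> n0 _ _ cd h x; rewrite (le_trans (h x)) // ler_wpM2r. Qed.

Lemma op_boundV nu y m : is_seminorm nu -> y \is a GRing.unit -> 0 < m ->
  (forall x, m * nu x <= nu (y * x)) -> op_bound nu y^-1 m^-1.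
Proof.
move=> nuS yU m0 h x; rewrite mulrC ler_pdivlMr // mulrC.
by have := h (y^-1 * x); rewrite mulVKr.
Qed.

(** [M] depends on the coefficients only. It has to precede [nu], because it fixes the threshold
    from which the seminorm is built. *)
Lemma op_bound_poly (q : {poly R[i]}) : exists2 M, 0 <= M &
  forall nu y c, is_seminorm nu -> 0 <= c <= 1 -> op_bound nu y c ->
    op_bound nu (horner_alg y q) M.
Proof.
elim/poly_ind: q => [|q k [M M0 hM]].
  exists 0 => // nu y c nuS _ _; rewrite rmorph0.
  by have := op_bound_scalar 0 nuS; rewrite scale0r normc0.
exists (M + normc k) => [|nu y c nuS c01 yc]; first by rewrite addr_ge0 ?normc_ge0.
rewrite rmorphD rmorphM /= horner_algX horner_algC.
apply: op_boundD => //; last exact: op_bound_scalar.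
rewrite -[M]mulr1; apply: op_boundM => //; first exact: hM c01 yc.
by case/andP: c01 => _ c1; exact: op_bound_le c1 yc.
Qed.

Lemma residual_num_factor p : (1 < p)%N ->
  exists q : {poly R[i]}, residual_num p 'X = q * 'X ^+ 2.
Proof.
move=> p1; set N : {poly R[i]} := residual_num p 'X.
have N0 : root N 0.
  by apply/rootP; rewrite horner_residual_num /residual_num !subr0 !addr0 subrr.
have N1 : root N^`() 0.
  apply/rootP; rewrite /N /residual_num; case: (p) p1 => // d _.
  have d1 : (1 : {poly R[i]})^`() = 0 by rewrite derivC.
  have dn n : (n%:R : {poly R[i]})^`() = 0 by rewrite -polyC_natr derivC.
  rewrite !(derivB, derivM, derivD, deriv_exp, derivX, d1, dn) /=.
  rewrite !(hornerE, horner_exp, hornerMn) /= !subr0 mul1r !mulN1r mulNrn.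
  have -> : (d.+1%:R : R[i]) ^+ d *+ d.+1 = d.+1%:R ^+ d.+1 by rewrite exprSr mulr_natr.
  by rewrite subrr addNr subr0.
clearbody N; have /factor_theorem[q1 qE] := N0; rewrite subr0 in qE.
move: N1; rewrite qE derivM derivX mulr1 => /rootP.
rewrite hornerD hornerM hornerX mulr0 add0r => /rootP/factor_theorem[q q1E].
by exists q; rewrite q1E subr0 expr2 mulrA.
Qed.

(* The numerator has a double zero at [0], where the denominator is nonzero. *)
Lemma residual_contraction p : (1 < p)%N -> exists2 e : R, 0 < e <= 1 / 8 &
  forall nu y c, is_seminorm nu -> 0 <= c <= e -> op_bound nu y c ->
    residual_den p y \is a GRing.unit ->
    op_bound nu (residual_num p y / residual_den p y) (c / 2).
Proof.
move=> p1; have [q NE] := residual_num_factor p1.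
pose D : {poly R[i]} := residual_den p 'X; pose k := D.[0].
have k0 : 0 < normc k.
  rewrite normc_gt0 /k horner_residual_den.
  by have [] := @residual_schwarz R p 0 p1; rewrite ?normc0.
have [d DE] : exists d : {poly R[i]}, D - k%:P = d * 'X.
  have /factor_theorem[d dE] : root (D - k%:P) 0.
    by apply/rootP; rewrite hornerD hornerN hornerC subrr.
  by exists d; rewrite dE subr0.
have [M M0 hM] := op_bound_poly q; have [L L0 hL] := op_bound_poly d.
(* Makes [e <= 1/8], [M e <= |k|/8] and [L e <= |k|/8] all at once. *)
pose e : R := 1 / 8 / (1 + M / normc k + L / normc k).
have s1 : 1 <= 1 + M / normc k + L / normc k.
  by rewrite -addrA lerDl addr_ge0 // divr_ge0 // ltW.
have s0 := lt_le_trans ltr01 s1.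
have e0 : 0 < e by rewrite !divr_gt0.
have es : e * (1 + M / normc k + L / normc k) = 1 / 8 by rewrite divfK ?gt_eqF.
have e8 : e <= 1 / 8 by rewrite -es ler_peMr // ltW.
have eM : 8 * (M * e) <= normc k.
  have : M / normc k <= 1 + M / normc k + L / normc k.
    by rewrite [1 + _]addrC -addrA lerDl addr_ge0 ?divr_ge0 // ltW.
  move/(ler_wpM2l (ltW e0)); rewrite es (_ : e * _ = M * e / normc k); last by ring.
  by rewrite ler_pdivrMr //; lra.
have eL : 8 * (L * e) <= normc k.
  have : L / normc k <= 1 + M / normc k + L / normc k.
    by rewrite lerDr addr_ge0 ?divr_ge0 // ltW.
  move/(ler_wpM2l (ltW e0)); rewrite es (_ : e * _ = L * e / normc k); last by ring.
  by rewrite ler_pdivrMr //; lra.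
exists e; first by rewrite e0.
move=> nu y c nuS /andP[c0 ce] yc DU.
have c1 : c <= 1 by lra.
have c01 : 0 <= c <= 1 by rewrite c0.
have Ny : op_bound nu (residual_num p y) (M * (c * c)).
  rewrite -horner_alg_residual_num NE rmorphM rmorphXn /= horner_algX expr2.
  by apply: op_boundM => //; [exact: hM c01 yc|exact: op_boundM].
(* The denominator is [k] plus a term of operator bound [L c <= |k| / 2], so it expands [nu] by at
   least [|k| / 2]. *)
have Dy : op_bound nu (residual_den p y)^-1 (normc k / 2)^-1.
  have [n0 nD nZ] := nuS.
  apply: op_boundV => //; first by rewrite divr_gt0.
  move=> x; have dy : op_bound nu (horner_alg y d * y) (L * c).
    by apply: op_boundM => //; exact: hL c01 yc.
  have -> : residual_den p y * x = k *: x + horner_alg y d * y * x.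
    have DE' : residual_den p 'X = d * 'X + k%:P by rewrite -DE subrK.
    rewrite -horner_alg_residual_den DE' rmorphD rmorphM /=.
    by rewrite horner_algX horner_algC mulrDl mulr_algl addrC.
  have := nD (k *: x + horner_alg y d * y * x) (- (horner_alg y d * y * x)).
  rewrite addrK -scaleN1r !nZ normcN normc1 mul1r.
  have := dy x; have Lc : L * c <= normc k / 2.
    by have := ler_wpM2l L0 ce; lra.
  have := ler_wpM2r (n0 x) Lc; lra.
have kn : normc k != 0 by rewrite gt_eqF.
apply: op_bound_le (op_boundM _ Ny Dy) => //; last by rewrite !mulr_ge0.
rewrite invf_div mulrA ler_pdivrMr //.
have Mc : M * c <= normc k / 8 by have := ler_wpM2l M0 ce; lra.
have := ler_wpM2r c0 Mc; have : 0 <= normc k * c by rewrite mulr_ge0 // ltW.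
by rewrite -!mulrA; lra.
Qed.

Definition power_seminorm (v : A) (e : R) n x : R :=
  \sum_(i < n) e ^- i * bnorm (v ^+ i * x).

(** Multiplication by [v] shifts the sum by one index at the cost of a factor [e]; the term pushed
    out at the end, with [v ^ n], is at most [e] times the initial term [bnorm x]. *)
Lemma power_seminormP v (e : R) n : 0 < e -> (0 < n)%N ->
  bnorm (v ^+ n) <= e ^+ n ->
  [/\ is_seminorm (power_seminorm v e n),
      op_bound (power_seminorm v e n) v e &
      forall x, bnorm x <= power_seminorm v e n x].
Proof.
move=> e0; case: n => // n _ vn; pose w i : R := e ^- i.
have w0 i : 0 <= w i by rewrite invr_ge0 exprn_ge0 // ltW.
have wS i : w i = e * w i.+1.
  by rewrite /w exprS invfM mulrA divff ?mul1r // gt_eqF.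
split.
- split=> [x|x y|k x].
  + by apply: sumr_ge0 => i _; rewrite mulr_ge0 ?bnorm_ge0 ?w0.
  + rewrite -big_split /=; apply: ler_sum => i _.
    by rewrite mulrDr -[leRHS]mulrDr ler_wpM2l ?w0 // bnormD.
  + rewrite mulr_sumr; apply: eq_bigr => i _.
    by rewrite -scalerAr bnormZ mulrCA.
- move=> x; rewrite /power_seminorm big_ord_recr big_ord_recl /= expr0 mul1r.
  rewrite mulrDr addrC invr1 mul1r; apply: lerD.
    rewrite mulrA -exprSr -/(w n) -[leRHS]mul1r.
    have -> : e = w n * e ^+ n.+1 by rewrite exprSr mulrA mulVf ?mul1r // expf_neq0 // gt_eqF.
    rewrite mul1r -mulrA ler_wpM2l ?w0 // (le_trans (bnormM _ _)) //.
    by rewrite ler_wpM2r ?bnorm_ge0.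
  rewrite mulr_sumr; apply: ler_sum => i _.
  by rewrite mulrA -exprSr -/(w i) wS mulrA.
- move=> x; rewrite /power_seminorm big_ord_recl expr0 invr1 !mul1r lerDl.
  by apply: sumr_ge0 => i _; rewrite mulr_ge0 ?bnorm_ge0 ?w0.
Qed.

End OperatorBound.

(** * Convergence to a root *)

Section Convergence.
Variables (R : realType) (A : unitalBanachAlgType R) (p : nat) (a : A).
Hypotheses (p1 : (1 < p)%N)
  (a_right : forall z, spectrum a z -> 0 < complex.Re z).
Let X k := halley p a k.
Let u k := cayley p a (X k).

Let XS k : X k.+1 = halley_map p a (X k). Proof. by []. Qed.

Lemma add1_unit : 1 + a \is a GRing.unit.
Proof.
rewrite -unitrN opprD -scaleN1r; apply: spectrumNP => /a_right /=.
by rewrite ltr0N1.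
Qed.

(** Here [1 - c u_0 = ((1 - c) + (1 + c) a) / (1 + a)]. It could be singular only if
    [- (1 - c) / (1 + c)] were a spectral value of [a], but its real part is nonpositive for
    [|c| <= 1]. At [c = -1] the numerator is the constant [2]. *)
Lemma cayley1_disc : disc_resolvent_unit (cayley p a 1).
Proof.
have U := add1_unit; move=> c c1; rewrite /cayley expr1n.
have -> : 1 - c *: ((1 - a) / (1 + a)) = ((1 - c)%:A + (1 + c) *: a) / (1 + a).
  apply: (mulIr U); rewrite divrK // mulrBl mul1r -scalerAl divrK //.
  by rewrite scalerBr scalerBl !scalerDl !scale1r opprB [c *: a - _]addrC addrACA.
rewrite unitrMl ?unitrV //.
have [c1'|c1'] := eqVneq (1 + c) 0.
  have -> : c = - 1 by apply/eqP; rewrite -subr_eq0 opprK addrC c1'.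
  rewrite subrr scale0r addr0 opprK; apply: scale_neq0_unit; rewrite ?unitr1 //.
have -> : (1 - c)%:A + (1 + c) *: a = (- (1 + c)) *: ((- ((1 - c) / (1 + c)))%:A - a).
  rewrite scalerBr scalerA mulrNN [(1 + c) * _]mulrC divfK //.
  by rewrite scaleNr opprK.
apply: scale_neq0_unit; first by rewrite oppr_eq0.
apply: spectrumNP => /a_right.
have -> : complex.Re (- ((1 - c) / (1 + c))) = - complex.Re ((1 - c) / (1 + c)).
  by case: (_ / _).
rewrite oppr_gt0 Rec_div ltNge divr_ge0 ?sqr_ge0 //.
have : normc c ^+ 2 <= 1 by rewrite exprn_ile1 ?normc_ge0.
rewrite sqr_normcE; case: (c) => x y /=; lra.
Qed.

Lemma halley_invariant : exists2 r : R, 0 < r < 1 & forall k,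
  [/\ bicommutes a (X k), X k ^+ p + a \is a GRing.unit &
      forall z, spectrum (u k) z -> normc z <= r ^+ k.+1].
Proof.
have [r r01 hr] := disc_resolvent_spectrum cayley1_disc.
exists r => //; case/andP: r01 => r0 r1.
have rk k : 0 <= r ^+ k.+1 <= 1.
  by rewrite exprn_ge0 ?exprn_ile1 // ltW.
elim=> [|k [bX SU uk]].
  split; [exact: bicommutes1|by rewrite expr1n add1_unit|].
  by move=> z; rewrite expr1; exact: hr.
have uk1 z : spectrum (u k) z -> normc z <= 1.
  by move=> /uk /le_trans; apply; case/andP: (rk k).
have [denU XE SU' uE] := halley_mapP p1 bX SU uk1.
split; [exact: bicommutes_halley_map|exact: SU'|].
move=> z; rewrite /u XS uE => /(spectrum_residual p1 (rk k) uk) /le_trans; apply.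
(* Cubing turns the exponent [k + 1] into [3 (k + 1)], which is at least [k + 2]. *)
rewrite -exprM; apply: ler_wiXn2l; rewrite ?(ltW r0) ?(ltW r1) //.
by rewrite mulnS -[k.+2]addn1 leq_add2l muln_gt0.
Qed.

Lemma halley_den_unit k : halley_den p a (X k) \is a GRing.unit.
Proof.
have [r /andP[r0 r1] /(_ k)[bX SU uk]] := halley_invariant.
have [] // := halley_mapP p1 bX SU _.
by move=> z /uk /le_trans; apply; rewrite exprn_ile1 // ltW.
Qed.

Lemma bicommutes_halley k : bicommutes a (X k).
Proof. by have [r _ /(_ k)[]] := halley_invariant. Qed.

Lemma halley_convergent : exists2 x, norm_cvg X x & x ^+ p = a.
Proof.
have [r /andP[r0 r1] inv] := halley_invariant.
have [e /andP[e0 e8] hcontr] := residual_contraction A p1.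
have [K rK] : exists K, r ^+ K.+1 < e.
  have /cvgrPdist_lt/(_ e e0)[N _ /(_ N.+1 (leqnSn N))] :
      r ^+ n @[n --> \oo] --> (0 : R) by apply: cvg_expr; rewrite ger0_norm // ltW.
  by rewrite /= sub0r normrN ger0_norm ?exprn_ge0 ?(ltW r0) // => h; exists N.
have inv1 k z : spectrum (u k) z -> normc z <= 1.
  by have [_ _ h] := inv k => /h /le_trans; apply; rewrite exprn_ile1 // ltW.
have [n n0 vn] : exists2 n, (0 < n)%N & bnorm (u K ^+ n) <= e ^+ n.
  apply: pow_le_of_spectrum => // z; have [_ _ h] := inv K.
  by move=> /h /le_lt_trans; apply.
(* The seminorm is adapted to the single element [u_K]; the contraction then controls all later
   [u_k] in this same seminorm. *)
have [nuS uKb nu_ge] := power_seminormP e0 n0 vn.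
set nu := power_seminorm _ _ _ in nuS uKb nu_ge.
have step k := halley_mapP p1 (let: And3 b _ _ := inv k in b)
  (let: And3 _ s _ := inv k in s) (inv1 k).
pose c j : R := e / 2 ^+ j.
have c0 j : 0 <= c j by rewrite divr_ge0 ?exprn_ge0 // ltW.
have cS j : c j.+1 = c j / 2 by rewrite /c exprS invfM mulrCA mulrC.
have ce j : c j <= e.
  by rewrite /c ler_pdivrMr ?exprn_gt0 // ler_peMr ?(ltW e0) // exprn_ege1 // ler1n.
have ub j : op_bound nu (u (K + j)%N) (c j).
  elim: j => [|j IH]; first by rewrite addn0 /c expr0 divr1.
  rewrite addnS cS /u XS; have [_ _ _ ->] := step (K + j)%N.
  apply: hcontr => //; first by rewrite c0 ce.
  by apply: residual_den_unit => //; exact: inv1.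
have [nu0 nuD nuZ] := nuS.
have nuN x : nu (- x) = nu x by rewrite -scaleN1r nuZ normcN normc1 mul1r.
have nu_nat m x : nu (m%:R * x) = m%:R * nu x.
  by rewrite mulr_natl -scaler_nat nuZ normc_nat.
have puV j : op_bound nu (p%:R + u (K + j)%N)^-1 1.
  rewrite -[X in op_bound _ _ X]invr1; apply: op_boundV => //.
    by have [] := natr_pm_unit p1 (inv1 (K + j)%N).
  move=> x; rewrite mul1r mulrDl.
  have := nuD (p%:R * x + u (K + j)%N * x) (- (u (K + j)%N * x)).
  rewrite addrK nuN nu_nat; have := ub j x.
  have : c j * nu x <= nu x by rewrite ler_piMl //; have := ce j; lra.
  have : 2 * nu x <= p%:R * nu x by rewrite ler_wpM2r // ler_nat.
  lra.
(* From [(p - u) / (p + u) = 1 - 2 u / (p + u)]. *)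
have diff j : nu (X (K + j.+1)%N - X (K + j)%N) <= 2 * c j * nu (X (K + j)%N).
  rewrite addnS XS; set k := (K + j)%N; have [_ -> _ _] := step k.
  have [bX SU _] := inv k; have bu : bicommutes a (u k) by exact: bicommutes_cayley.
  have [puU _] := natr_pm_unit p1 (inv1 k).
  rewrite -/(u k) (_ : _ - _ = - (2%:R * (u k * ((p%:R + u k)^-1 * X k)))).
    rewrite nuN nu_nat -mulrA ler_wpM2l // (le_trans (ub j _)) // ler_wpM2l //.
    by rewrite (le_trans (puV j _)) // mul1r.
  have -> : (p%:R - u k) / (p%:R + u k) = 1 - 2%:R * (u k / (p%:R + u k)).
    apply: (mulIr puU); rewrite divrK // mulrBl mul1r -!mulrA mulVr // mulr1.
    by rewrite mulr_natl mulr2n opprD addrA addrK.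
  rewrite mulrBr mulr1 addrAC subrr add0r; congr (- _).
  rewrite (mulrA (X k)) (commr_nat (X k) 2) -!mulrA; congr (_ * _).
  have bpu : bicommutes a (p%:R + u k) by apply: bicommutesD => //; exact: bicommutes_nat.
  rewrite [RHS]mulrA (bicommutes_comm bX) ?mulrA //.
  by apply: bicommutesM => //; exact: bicommutesV.
pose E := nu (X K); have E0 : 0 <= E by exact: nu0.
have h0 j : 0 <= 2^-1 ^+ j :> R by rewrite exprn_ge0 // invr_ge0.
have h1 j : 2^-1 ^+ j <= 1 :> R.
  by rewrite exprn_ile1 ?invr_ge0 // invf_le1 ?ler1n.
have cE j : 2 * c j <= 2^-1 ^+ j / 4.
  have := ler_wpM2r (h0 j) e8; rewrite /c -exprVn; lra.
(* Each step multiplies [nu] by at most [1 + 2^-j / 4]. The bound rises from [E] towards [3 E], and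
   its correction term leaves room for this growth. *)
have Xb j : nu (X (K + j)%N) <= E * (3 - 2 * 2^-1 ^+ j).
  elim: j => [|j IH]; first by rewrite addn0 expr0 -/E; lra.
  have := nuD (X (K + j)%N) (X (K + j.+1)%N - X (K + j)%N).
  rewrite addrC subrK => /le_trans; apply.
  have := diff j; have := ler_wpM2r (nu0 (X (K + j)%N)) (cE j).
  set t := 2^-1 ^+ j in h0 h1 IH *; have t0 : 0 <= t := h0 j.
  have t1 : t <= 1 := h1 j; rewrite exprS -/t => d1 d2.
  have : (1 + t / 4) * nu (X (K + j)%N) <= (1 + t / 4) * (E * (3 - 2 * t)).
    by rewrite ler_wpM2l //; lra.
  have : 0 <= E * t * (1 + 2 * t) by rewrite !mulr_ge0 //; lra.
  lra.
have [x Xx] : exists x, norm_cvg (fun j => X (j + K)%N) x.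
  apply: (@bnorm_cvg_geometric _ _ _ (3 / 4 * E) 2^-1).
    by rewrite invr_ge0 ler0n invf_lt1 // ltr1n.
  move=> j; rewrite [(j.+1 + K)%N]addnC [(j + K)%N]addnC.
  apply: le_trans (nu_ge _) _; apply: le_trans (diff j) _.
  have h3 : nu (X (K + j)%N) <= E * 3.
    by apply: le_trans (Xb j) _; rewrite ler_wpM2l //; have := h0 j; lra.
  have := ler_wpM2r (nu0 (X (K + j)%N)) (cE j).
  have := ler_wpM2l (h0 j) h3; lra.
have u0 : norm_cvg (fun j => u (j + K)%N) 0.
  apply/bnorm_cvgP => d d0.
  have D0 : 0 < nu 1 + 1 by rewrite ltr_wpDl.
  have /cvgrPdist_lt/(_ (d / (nu 1 + 1)))[|N _ cN] :
      2^-1 ^+ n @[n --> \oo] --> (0 : R).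
  - by apply: cvg_expr; rewrite ger0_norm ?invr_ge0 // invf_lt1 // ltr1n.
  - by rewrite divr_gt0.
  exists N => j /cN; rewrite /= sub0r normrN ger0_norm // ltr_pdivlMr // subr0.
  apply: le_lt_trans; rewrite addnC -[u _]mulr1; apply: le_trans (nu_ge _) _.
  apply: le_trans (ub j 1) _; apply: ler_pM => //; last by rewrite lerDl.
  rewrite /c -exprVn ler_piMl //; lra.
exists x; first exact: bnorm_cvg_shift Xx.
(* The sequence [X^p - a = u (X^p + a)] has two limits, [x^p - a] and [0]. *)
have l1 : norm_cvg (fun j => X (j + K)%N ^+ p - a) (x ^+ p + - a).
  exact: bnorm_cvgD (bnorm_cvgX p Xx) (bnorm_cvg_cst _).
have l2 : norm_cvg (fun j => X (j + K)%N ^+ p - a) (0 * (x ^+ p + a)).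
  apply: eq_bnorm_cvg (bnorm_cvgM u0 (bnorm_cvgD (bnorm_cvgX p Xx) (bnorm_cvg_cst a))).
  move=> j; rewrite /u /cayley divrK //; by have [] := inv (j + K)%N.
by apply/eqP; rewrite -subr_eq0 (bnorm_cvg_unique l1 l2) mul0r.
Qed.

End Convergence.

(** * The principal root *)

Section PrincipalRoot.
Variables (R : realType) (A : unitalBanachAlgType R) (p : nat) (a : A).
Hypotheses (p1 : (1 < p)%N)
  (a_right : forall z, spectrum a z -> 0 < complex.Re z).

Lemma halley_fracE k :
  horner_alg a (halley_frac R p k).2 \is a GRing.unit /\
  halley p a k = horner_alg a (halley_frac R p k).1 / horner_alg a (halley_frac R p k).2.
Proof.
elim: k => [|k [QU XE]].
  by rewrite /= !rmorph1 unitr1 divr1.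
have dU := halley_den_unit p1 a_right k.
have E : halley p a k.+1 = halley p a k *
  (halley_num p a (halley p a k) / halley_den p a (halley p a k)) by [].
rewrite E; move: (halley p a k) XE dU {E} => x XE dU.
rewrite /=; case: (halley_frac R p k) QU XE => P Q /= QU XE.
rewrite !(rmorphM, rmorphD, rmorphXn) /= !rmorph_nat horner_algX.
have cm (f g : {poly R[i]}) : GRing.comm (horner_alg a f) (horner_alg a g).
  by rewrite /GRing.comm -!rmorphM mulrC.
have ca (f : {poly R[i]}) : GRing.comm a (horner_alg a f).
  by have := cm 'X f; rewrite horner_algX.
set P' := horner_alg a P in XE *; set Q' := horner_alg a Q in QU XE *.
have PQ : GRing.comm P' Q' by exact: cm.
have aQ : GRing.comm a Q' by exact: ca.
have aP : GRing.comm a P' by exact: ca.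
have xQ : x ^+ p * Q' ^+ p = P' ^+ p.
  rewrite XE exprMn_comm; last exact: commrV.
  by rewrite exprVn mulrVK ?unitrX.
have den : p.+1%:R * P' ^+ p + p.-1%:R * a * Q' ^+ p = halley_den p a x * Q' ^+ p.
  by rewrite mulrDl -!mulrA xQ.
have num : p.-1%:R * P' ^+ p + p.+1%:R * a * Q' ^+ p = halley_num p a x * Q' ^+ p.
  by rewrite mulrDl -!mulrA xQ.
have QpU : Q' ^+ p \is a GRing.unit by rewrite unitrX.
rewrite den num; split; first by rewrite unitrMl // unitrMl.
have dQ : GRing.comm (halley_den p a x) Q'.
  have xQ' : GRing.comm x Q'.
    rewrite XE; apply: commr_sym; apply: commrM; first exact: commr_sym.
    by apply: commrV; exact: commr_refl.
  apply: commr_sym; apply: commrD; apply: commrM; first exact: commr_nat.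
  - by apply: commrX; exact: commr_sym.
  - exact: commr_nat.
  - exact: commr_sym.
have nQ : GRing.comm (halley_num p a x) Q'.
  have xQ' : GRing.comm x Q'.
    rewrite XE; apply: commr_sym; apply: commrM; first exact: commr_sym.
    by apply: commrV; exact: commr_refl.
  apply: commr_sym; apply: commrD; apply: commrM; first exact: commr_nat.
  - by apply: commrX; exact: commr_sym.
  - exact: commr_nat.
  - exact: commr_sym.
have DU : Q' * (halley_den p a x * Q' ^+ p) \is a GRing.unit by rewrite !unitrMl.
have e1 : Q' * (halley_den p a x * Q' ^+ p) = halley_den p a x * (Q' * Q' ^+ p).
  by rewrite mulrA -dQ -mulrA.
have xQ1 : x * Q' = P' by rewrite XE divrK.
apply: (mulIr DU); rewrite divrK // e1 -!mulrA mulKr //.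
by rewrite (mulrA (halley_num p a x)) nQ -(mulrA Q') (mulrA x) xQ1.
Qed.

Lemma halley_spectrum_sector k l :
  spectrum (halley p a k) l -> sector (pi / p%:R) l.
Proof.
have [QU ->] := halley_fracE k; move=> /(spectrum_fraction QU)[z /a_right z0 E].
by have [Q0] := halley_frac_sector p1 k z0; rewrite E mulfK.
Qed.

(** Perturbation yields only the closed sector; the boundary is excluded because [l ^ p] is a
    spectral value of [a]. *)
Lemma limit_spectrum_sector x l : norm_cvg (halley p a) x -> x ^+ p = a ->
  spectrum x l -> 0 < sector_gap (pi / p%:R) l.
Proof.
move=> Xx xa xl; have [t0 t2] := pi_div_bounds R p1.
apply: sector_gap_root => //; last first.
  by apply: a_right; rewrite -xa; exact: spectrum_exp.
have bx : bicommutes a x := bicommutes_cvg (bicommutes_halley p1 a_right) Xx.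
(* The gap has Lipschitz constant [2], so within distance [e] of [l] it is still at most half its
   negative value at [l]. *)
rewrite leNgt; apply/negP => g0; pose e := - sector_gap (pi / p%:R) l / 4.
have e0 : 0 < e by rewrite divr_gt0 // oppr_gt0.
have [N /(_ N (leqnn N)) hN] := (bnorm_cvgP _ _).1 Xx e e0.
have cx : GRing.comm x (halley p a N).
  exact: bicommutes_comm bx (bicommutes_halley p1 a_right N).
rewrite bnormBC in hN.
have [m /halley_spectrum_sector/(sector_gap_ge0 t0 t2) gm lm] :=
  spectrum_perturbation e0 cx hN xl.
have := sector_gap_lipschitz t0 t2 m l; rewrite normcBC.
rewrite /e in lm; lra.
Qed.

End PrincipalRoot.

(** The idempotent [e] separates two corners, on which [g] and [l] are inverted independently. *)
Lemma corner_unit (R : realType) (A : unitalBanachAlgType R) (e g : A) (l : R[i]) :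
  e * e = e -> GRing.comm e g -> g \is a GRing.unit -> l != 0 ->
  g * e + l *: (1 - e) \is a GRing.unit.
Proof.
move=> ee eg gU l0; have f0 : (1 - e) * e = 0 by rewrite mulrBl mul1r ee subrr.
have f0' : e * (1 - e) = 0 by rewrite mulrBr mulr1 ee subrr.
have ff : (1 - e) * (1 - e) = 1 - e by rewrite mulrBr mulr1 f0 subr0.
have eV : GRing.comm e g^-1 by exact: commrV.
have corner (h k : A) (c d : R[i]) : GRing.comm e h -> GRing.comm e k ->
    k * h = 1 -> d * c = 1 -> (k * e + d *: (1 - e)) * (h * e + c *: (1 - e)) = 1.
  move=> eh ek kh dc; have p1 : (k * e) * (h * e) = e.
    by rewrite -mulrA (mulrA e h) eh -(mulrA h) ee mulrA kh mul1r.
  have p2 : (k * e) * (1 - e) = 0 by rewrite -mulrA f0' mulr0.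
  have p3 : (1 - e) * (h * e) = 0 by rewrite -eh mulrA f0 mul0r.
  rewrite mulrDl !mulrDr -!scalerAl -!scalerAr p1 p2 p3 ff !scaler0 addr0 add0r.
  by rewrite scalerA dc scale1r addrC subrK.
apply/unitrP; exists (g^-1 * e + l^-1 *: (1 - e)).
by split; apply: corner => //; rewrite ?mulVr ?mulrV ?mulVf ?mulfV.
Qed.

(* [e] is the spectral idempotent of [b / x] at the root of unity [c]: on its
   range [b] is [c] times [x], so a nonzero spectral value [l] of [x * e] puts
   both [l] in the spectrum of [x] and [c * l] in that of [b]. *)
Lemma principal_root_unique (R : realType) (A : unitalBanachAlgType R) p (b x : A) :
  (1 < p)%N -> GRing.comm b x -> b ^+ p = x ^+ p -> x \is a GRing.unit ->
  (forall l, spectrum b l -> 0 < sector_gap (pi / p%:R) l) ->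
  (forall l, spectrum x l -> 0 < sector_gap (pi / p%:R) l) -> b = x.
Proof.
move=> p1 bx bxp xU gb gx; pose y := b / x.
have yx : GRing.comm y x.
  apply: commr_sym; apply: commrM; first exact: commr_sym.
  by apply: commrV; exact: commr_refl.
have yp : y ^+ p = 1.
  by rewrite exprMn_comm ?exprVn ?bxp ?mulrV ?unitrX //; exact: commrV.
have p0 : (p%:R : R[i]) != 0 by rewrite pnatr_eq0 -lt0n ltnW.
pose s : {poly R[i]} := \sum_(i < p) 'X^i.
have sy : horner_alg y s = \sum_(i < p) y ^+ i.
  by rewrite rmorph_sum; apply: eq_bigr => i _; rewrite rmorphXn /= horner_algX.
(* [(y - 1) s(y) = y^p - 1 = 0], so a unit [s(y)] forces [y = 1]. The roots of [s] are the
   nontrivial roots of unity [c]. *)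
suff sU : horner_alg y s \is a GRing.unit.
  have : (y - 1) * horner_alg y s = 0 by rewrite sy -subrX1 yp subrr.
  move=> /(canRL (mulrK sU)); rewrite mul0r => /eqP.
  by rewrite subr_eq0 => /eqP y1; rewrite -[b](divrK xU) -/y y1 mul1r.
have sE c : s.[c] = \sum_(i < p) c ^+ i.
  by rewrite horner_sum; apply: eq_bigr => i _; rewrite hornerXn.
have s1 : s.[1] = p%:R.
  rewrite sE (eq_bigr (fun=> 1)) => [|i _]; last by rewrite expr1n.
  by rewrite sumr_const card_ord.
apply: horner_alg_unit.
  by apply/eqP => s0; move: s1 p0; rewrite s0 horner0 => <-; rewrite eqxx.
move=> c /rootP; rewrite sE => sc.
have cp : c ^+ p = 1 by apply/eqP; rewrite -subr_eq0 subrX1 sc mulr0.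
have c1 : c != 1.
  by apply/eqP => c1; move: s1 p0; rewrite sE -c1 sc => <-; rewrite eqxx.
have c0 : c != 0.
  by apply/eqP => c0; move: cp => /eqP; rewrite c0 expr0n gtn_eqF ?(ltnW p1) // eq_sym oner_eq0.
pose w := c^-1 *: y; have wp : w ^+ p = 1 by rewrite exprZn yp exprVn cp invr1 scale1r.
pose e := (p%:R)^-1 *: \sum_(i < p) w ^+ i : A.
have we : w * e = e.
  apply/eqP; rewrite -subr_eq0 -[X in _ - X]mul1r -mulrBl -scalerAr -subrX1.
  by rewrite wp subrr scaler0.
have wie i : w ^+ i * e = e.
  by elim: i => [|i IH]; rewrite ?expr0 ?mul1r // exprS -mulrA IH.
have ee : e * e = e.
  rewrite {1}/e -scalerAl mulr_suml (eq_bigr (fun=> e)) => [|i _]; last exact: wie.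
  by rewrite sumr_const card_ord -[e *+ p]scaler_nat scalerA mulVf // scale1r.
have xw : GRing.comm x w.
  by apply: commr_scale; exact: commr_sym.
have xe : GRing.comm x e.
  by apply: commr_scale; apply: commr_sum => i _; exact: commrX.
have eb : GRing.comm b e.
  have bw : GRing.comm b w.
    by apply: commr_scale; apply: commrM; [exact: commr_refl|exact: commrV].
  by apply: commr_scale; apply: commr_sum => i _; exact: commrX.
have be : b * e = c *: (x * e).
  have wx : w * x = c^-1 *: b by rewrite /w -scalerAl divrK.
  have bE : b = c *: (w * x) by rewrite wx scalerA divff // scale1r.
  by rewrite [in LHS]bE -scalerAl -xw -mulrA we.
have lift l : l != 0 -> ~ spectrum (x * e) l.
  move=> l0 xel; move/eqP: c1; apply; apply: (@sector_root_inj R p l c) => //.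
    apply: gx; apply: contrapT => /spectrumNP lU; move/negP: xel; apply.
    have -> : l%:A - x * e = (l%:A - x) * e + l *: (1 - e).
      by rewrite mulrBl mulr_algl scalerBr [RHS]addrC subrKA.
    apply: corner_unit => //; apply: commrB; first exact: commr_scalar.
    exact: commr_sym.
  apply: gb; apply: contrapT => /spectrumNP lU; move/negP: xel; apply.
  have -> : l%:A - x * e = (c^-1 *: ((c * l)%:A - b)) * e + l *: (1 - e).
    rewrite -scalerAl mulrBl be mulr_algl -(scalerA c l e) -(scalerBr c) (scalerA c^-1).
    by rewrite mulVf // scale1r scalerBr [RHS]addrC subrKA.
  apply: corner_unit => //; last by apply: scale_neq0_unit; rewrite ?invr_eq0.
  by apply: commr_scale; apply: commrB; [exact: commr_scalar|exact: commr_sym].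
(* By [lift], [x e] has no nonzero spectral value, so some power of it is small. Then
   [e = x^-n (x e)^n] has norm below [1], which is impossible for a nonzero idempotent. *)
have e0 : e = 0.
  have xi0 : 0 < bnorm x^-1.
    rewrite lt0r bnorm_ge0 andbT bnorm_eq0 invr_eq0.
    by apply/eqP => x0; rewrite x0 unitr0 in xU.
  have d0 : 0 < 1 / 2 / bnorm x^-1 by rewrite !divr_gt0.
  have [l xel|n n0 hn] := pow_le_of_spectrum d0 (u := x * e).
    have [->|l0] := eqVneq l 0; first by rewrite normc0.
    by case: (lift l l0 xel).
  have en k : e ^+ k.+1 = e.
    by elim: k => [|k IH]; rewrite ?expr1 // exprS IH ee.
  have eE : e = x^-1 ^+ n * (x * e) ^+ n.
    rewrite exprMn_comm // -[in RHS](prednK n0) en prednK // mulrA exprVn.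
    by rewrite mulVr ?mul1r // unitrX.
  have le : bnorm e <= (1 / 2) ^+ n.
    rewrite eE (le_trans (bnormM _ _)) //.
    have -> : (1 / 2 : R) ^+ n = bnorm x^-1 ^+ n * (1 / 2 / bnorm x^-1) ^+ n.
      by rewrite -exprMn [bnorm _ * _]mulrC divfK // gt_eqF.
    by rewrite ler_pM ?bnorm_ge0 ?bnormX.
  have lt1 : bnorm e < 1.
    by apply: le_lt_trans le _; rewrite exprn_ilt1 -?lt0n //; lra.
  apply/eqP; rewrite -bnorm_eq0; have := bnormM e e; rewrite ee.
  rewrite eq_le bnorm_ge0 andbT; have := bnorm_ge0 e; nra.
have sw : horner_alg w s = 0.
  have : e = (p%:R)^-1 *: horner_alg w s.
    rewrite /e rmorph_sum; congr (_ *: _); apply: eq_bigr => i _.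
    by rewrite rmorphXn /= horner_algX.
  rewrite e0 => /(congr1 (GRing.scale (p%:R : R[i]))).
  by rewrite scaler0 scalerA divff // scale1r.
(* Evaluated at [w], where [s] vanishes, this reads [- p = t(w) (w - 1)], so [w - 1] is a unit. *)
have [t tE] : exists t : {poly R[i]}, s - (p%:R)%:P = t * ('X - 1%:P).
  have /factor_theorem[t tE] : root (s - (p%:R)%:P) 1.
    by apply/rootP; rewrite hornerD hornerN hornerC s1 subrr.
  by exists t.
have := congr1 (horner_alg w) tE.
rewrite rmorphB rmorphM rmorphB /= sw sub0r !horner_algC horner_algX scale1r => e1.
have wU : w - 1 \is a GRing.unit.
  have : - (p%:R : R[i])%:A \is a @GRing.unit A.
    by rewrite unitrN; apply: scale_neq0_unit; rewrite ?unitr1.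
  rewrite e1 unitrM_comm; first by case/andP.
  have := mulrC t ('X - 1%:P) => /(congr1 (horner_alg w)).
  by rewrite !rmorphM rmorphB /= horner_algX horner_algC scale1r.
have -> : c%:A - y = (- c) *: (w - 1).
  by rewrite /w scalerBr scalerA mulNr divff // scaleN1r scaleNr opprK addrC.
by apply: scale_neq0_unit; rewrite ?oppr_eq0.
Qed.

Lemma strictly_accretive_spectrum (R : realType) (A : unitalBanachAlgType R) (a : A) z :
  strictly_accretive a -> spectrum a z -> 0 < complex.Re z.
Proof. by move=> ha /spectrum_numerical_range /ha. Qed.

Theorem proposition7p5 (R : realType) (A : unitalBanachAlgType R)
    (p : nat) (hp : (1 < p)%N) (a : A) (ha : strictly_accretive a) :
  (forall k : nat, halley_den p a (halley p a k) \is a GRing.unit) /\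
  exists2 r : A, unique (principal_root p a) r & norm_cvg (halley p a) r.
Proof.
have a_right z : spectrum a z -> 0 < complex.Re z := strictly_accretive_spectrum ha.
split; first exact: halley_den_unit.
have [x Xx xa] := halley_convergent hp a_right; exists x => //.
have [t0 t2] := pi_div_bounds R hp.
have gx l : spectrum x l -> 0 < sector_gap (pi / p%:R) l.
  exact: (limit_spectrum_sector hp a_right Xx xa).
have aU : a \is a GRing.unit.
  have /spectrumNP : ~ spectrum a 0 by move=> /a_right; rewrite ltxx.
  by rewrite scale0r sub0r unitrN.
have xU : x \is a GRing.unit by rewrite -(unitrX_pos _ (ltnW hp)) xa.
split; first by split=> // l /gx gl; apply/interior_sectorE.
move=> b [ba bs]; apply/esym/(principal_root_unique hp) => //.
(* The root [b] commutes with [a = b ^ p], hence with the limit [x], which lies in the bicommutant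
   of [a]. *)
- have bx := bicommutes_cvg (bicommutes_halley hp a_right) Xx.
  by apply: bx; rewrite -ba; apply: commrX; exact: commr_refl.
- by rewrite ba xa.
- by move=> l /bs /interior_sectorE; apply.
Qed.
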